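(* Let $\mathbb{A}$ be an associative unital algebra over an algebraically closed field $\Bbbk$ of characteristic zero equipped with a double transposed Poisson bracket $\llbracket-,-\rrbracket$, and let $\delta:\mathbb{A}\to\mathbb{A}\otimes\mathrm{S}(\mathbb{A}_\natural)=\mathcal{O}(\mathbb{A})^{(1)}$, $\delta(a)=\llbracket\mathbb 1_{\mathcal{O}(\mathbb{A})},\widehat a\rrbracket$, be the associated derivation. The following conditions are equivalent. (i) The bracket restricts to $\widehat{\mathbf T\mathbb{A}}$, i.e. $\llbracket\widehat\alpha,\widehat\beta\rrbracket\in\widehat{\mathbb{A}^{\otimes(r+s)}}$ for all $\alpha\in\mathbb{A}^{\otimes r}$ and $\beta\in\mathbb{A}^{\otimes s}$ with $r,s\ge0$. (ii) $\delta(\mathbb{A})\subset\mathbb{A}\otimes\Bbbk\mathbb 1$. (iii) There exists a unique $D\in\operatorname{Der}(\mathbb{A})$ such that $\delta(a)=D(a)\otimes\mathbb 1$ for all $a\in\mathbb{A}$. When these equivalent conditions hold, the bracket preserves the subalgebra $\widehat{\mathbf T\mathbb{A}}=\bigoplus_{n\ge0}\widehat{\mathbb{A}^{\otimes n}}$, and under the identification of $\mathbf T\mathbb{A}$ with $\widehat{\mathbf T\mathbb{A}}$ its restriction yields a family of $\Bbbk$-bilinear operations $\llbracket-,-\rrbracket^{(r,s)}:\mathbb{A}^{\otimes r}\otimes\mathbb{A}^{\otimes s}\to\mathbb{A}^{\otimes(r+s)}$ ($r,s\ge1$) which is an $\mathrm{id}$-adapted double transposed Poisson algebra structure on $\mathbb{A}$,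 explicitly $$\llbracket\alpha,\beta\rrbracket^{(r,s)}=\alpha\otimes D(\beta)-D(\alpha)\otimes\beta,\qquad\alpha\in\mathbb{A}^{\otimes r},\ \beta\in\mathbb{A}^{\otimes s},$$ with $D$ extended to tensor powers by $D(a^1\otimes\cdots\otimes a^n)=\sum_k a^1\otimes\cdots\otimes D(a^k)\otimes\cdots\otimes a^n$. Conversely, every $\mathrm{id}$-adapted double transposed Poisson algebra structure on $\mathbb{A}$ arises in this way from a unique double transposed Poisson bracket on $\mathbb{A}$ satisfying the equivalent conditions (i)–(iii).
   Context: Tensor products are over $\Bbbk$. Permutations. For $w\in S_n,\tau\in S_m$, $w\times\tau\in S_{n+m}$ is their concatenation ($w$ on $1..n$, $\tau$ shifted on $n+1..n+m$); permutations of fewer letters are extended by fixing the last letters. For $\tau\in S_m$, $\tau^{k_1,\dots,k_m}\in S_{k_1+\dots+k_m}$ permutes $m$ consecutive blocks of lengths $k_1,\dots,k_m$ according to $\tau$ (block $i$ goes to block position $\tau(i)$); e.g. $(12)^{n,m}(j)=m+j$ for $j\le n$ and $j-n$ for $j>n$. For $u\in S_{n+1}$, $u_*\in S_n$ is given by $u_*(j)=u(j+1)-1$ if $u(j+1)\ne1$ and $u_*(j)=u^2(j+1)-1$ if $u(j+1)=1$. Double coordinate ring. $\mathbb{A}_\natural=\mathbb{A}/[\mathbb{A},\mathbb{A}]$ (quotient by the span of commutators), $a\mapsto\overline a$; $\mathrm{S}(\mathbb{A}_\natural)$ is its symmetric algebra, with unit $\mathbb 1$. $\mathcal{O}(\mathbb{A})=\bigoplus_{n\ge0}\mathcal{O}(\mathbb{A})^{(n)}$,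 $\mathcal{O}(\mathbb{A})^{(n)}=\mathbb{A}^{\otimes n}\otimes\mathrm{S}(\mathbb{A}_\natural)\otimes\Bbbk[S_n]$, with product $(a\otimes f\otimes u)(b\otimes g\otimes v)=(a\otimes b)\otimes fg\otimes(u\times v)$, unit $\mathbb 1_{\mathcal{O}(\mathbb{A})}=\mathbb 1\otimes\mathrm{id}_0$, and $S_n$-bimodule structure $\sigma\cdot(a\otimes f\otimes u)\cdot\tau=\sigma(a)\otimes f\otimes\sigma u\tau$, where $\sigma(a_1\otimes\cdots\otimes a_n)$ has $a_k$ in position $\sigma(k)$. $|\alpha|=n$ for $\alpha\in\mathcal{O}(\mathbb{A})^{(n)}$; $\operatorname{Ad}(\sigma)(\alpha)=\sigma\cdot\alpha\cdot\sigma^{-1}$. An $\mathbb{S}$-bimodule map $\mathcal{O}(\mathbb{A})\otimes_{\mathbb S}\mathcal{O}(\mathbb{A})\to\mathcal{O}(\mathbb{A})$ means a bilinear operation whose restrictions $\mathcal{O}(\mathbb{A})^{(n)}\otimes\mathcal{O}(\mathbb{A})^{(m)}\to\mathcal{O}(\mathbb{A})^{(n+m)}$ are $(S_n\times S_m)$-bimodule maps (target via concatenation). Maps $\pi$ and $\widehat1$. $\pi:\mathcal{O}(\mathbb{A})\to\mathcal{O}(\mathbb{A})$ has degree $-1$, vanishes on degree $0$, and for $a=a_1\otimes\cdots\otimes a_n$, $n\ge1$: $\pi(a\otimes f\otimes u)=(a_2\otimes\cdots\otimes a_n)\otimes\overline{a_1}f\otimes u_*$ if $u(1)=1$; $\pi(a\otimes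 f\otimes u)=m_{1,u(1)}(a)\otimes f\otimes u_*$ if $u(1)>1$, where $m_{1,k}$ removes the first factor and replaces $a_k$ by $a_1a_k$. $\widehat1$ is left multiplication by $1\otimes\mathbb 1\otimes\mathrm{id}_1\in\mathcal{O}(\mathbb{A})^{(1)}$. Double transposed Poisson bracket on $\mathbb{A}$: an $\mathbb{S}$-bimodule map $\llbracket-,-\rrbracket:\mathcal{O}(\mathbb{A})\otimes_{\mathbb S}\mathcal{O}(\mathbb{A})\to\mathcal{O}(\mathbb{A})$ such that for all homogeneous $\alpha,\beta,\gamma\in\mathcal{O}(\mathbb{A})$: $\llbracket\beta,\alpha\rrbracket=-\operatorname{Ad}((12)^{|\alpha|,|\beta|})\llbracket\alpha,\beta\rrbracket$; $\llbracket\alpha,\llbracket\beta,\gamma\rrbracket\rrbracket+\operatorname{Ad}((123)^{|\beta|,|\gamma|,|\alpha|})\llbracket\beta,\llbracket\gamma,\alpha\rrbracket\rrbracket+\operatorname{Ad}((132)^{|\gamma|,|\alpha|,|\beta|})\llbracket\gamma,\llbracket\alpha,\beta\rrbracket\rrbracket=0$; $2\gamma\llbracket\alpha,\beta\rrbracket=\llbracket\gamma\alpha,\beta\rrbracket+\operatorname{Ad}((12)^{|\alpha|,|\gamma|})\llbracket\alpha,\gamma\beta\rrbracket$; $\llbracket\pi(\alpha),\beta\rrbracket=\pi\llbracket\alpha,\beta\rrbracket$; and $\llbracket\widehat1(\alpha),\beta\rrbracket=\widehat1\llbracket\alpha,\beta\rrbracket$. The map $\delta$ in the claim is a derivation: $\delta(ab)=a\cdot\delta(b)+\delta(a)\cdot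 b$ with $b\cdot(c\otimes f)\cdot d=bcd\otimes f$. Embedding. $\mathbf T\mathbb{A}=\bigoplus_{n\ge0}\mathbb{A}^{\otimes n}$; for $\alpha\in\mathbb{A}^{\otimes n}$, $\widehat\alpha=\alpha\otimes\mathbb 1\otimes\mathrm{id}_n\in\mathcal{O}(\mathbb{A})^{(n)}$, and $\widehat{\mathbb{A}^{\otimes n}}=\mathbb{A}^{\otimes n}\otimes\Bbbk\mathbb 1\otimes\Bbbk\,\mathrm{id}_n$; $\alpha\mapsto\widehat\alpha$ is an injective homomorphism of associative unital algebras $\mathbf T\mathbb{A}\to\mathcal{O}(\mathbb{A})$, with image $\widehat{\mathbf T\mathbb{A}}$. $\mathrm{id}$-adapted double transposed Poisson algebra structure: $\Bbbk$-linear maps $\llbracket-,-\rrbracket^{(r,s)}:\mathbb{A}^{\otimes r}\otimes\mathbb{A}^{\otimes s}\to\mathbb{A}^{\otimes(r+s)}$, $r,s\ge1$, satisfying the following, with $\mathrm m_{u,v}$ removing the $u$-th factor and replacing the $v$-th by $a^ua^v$, $b\otimes_\rho$ inserting $b$ right after position $\rho$ (first if $\rho=0$), and $\tau_\sigma^{m_1,\dots,m_\ell}$ moving the $k$-th of consecutive blocks of lengths $m_1,\dots,m_\ell$ to position $\sigma(k)$ (remaining factors fixed; $\tau_{(23)}^{t,s}$ swaps the second and third blocks, of lengths $t,s$, after a first block of length $r$): for all $\alpha\in\mathbb{A}^{\otimes r},\beta\in\mathbb{A}^{\otimes s},\gamma\in\mathbb{A}^{\otimes t}$, $r,s,t\ge1$,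 (1) $\llbracket\alpha,\beta\rrbracket^{(r,s)}=-\tau_{(12)}^{s,r}\llbracket\beta,\alpha\rrbracket^{(s,r)}$; (2) $\llbracket\alpha,\llbracket\beta,\gamma\rrbracket^{(s,t)}\rrbracket^{(r,s+t)}+\tau_{(123)}^{s,t,r}\llbracket\beta,\llbracket\gamma,\alpha\rrbracket^{(t,r)}\rrbracket^{(s,r+t)}+\tau_{(132)}^{t,r,s}\llbracket\gamma,\llbracket\alpha,\beta\rrbracket^{(r,s)}\rrbracket^{(t,r+s)}=0$; (3) $2\gamma\otimes\llbracket\alpha,\beta\rrbracket^{(r,s)}=\llbracket\gamma\otimes\alpha,\beta\rrbracket^{(t+r,s)}+\tau_{(12)}^{r,t}\llbracket\alpha,\gamma\otimes\beta\rrbracket^{(r,t+s)}$; (4) $2\llbracket\alpha,\beta\rrbracket^{(r,s)}\otimes\gamma=\tau_{(132)}^{t,r,s}\llbracket\gamma\otimes\alpha,\beta\rrbracket^{(t+r,s)}+\tau_{(23)}^{t,s}\llbracket\alpha,\gamma\otimes\beta\rrbracket^{(r,t+s)}$; (5) $\llbracket1,\beta\rrbracket^{(1,s)}\in\Bbbk1\otimes\mathbb{A}^{\otimes s}$; (6) $\llbracket1\otimes_\rho\alpha,\beta\rrbracket^{(r+1,s)}=1\otimes_\rho\llbracket\alpha,\beta\rrbracket^{(r,s)}$, $\llbracket\alpha,1\otimes_\varsigma\beta\rrbracket^{(r,s+1)}=1\otimes_{r+\varsigma}\llbracket\alpha,\beta\rrbracket^{(r,s)}$ for $0\le\rho\le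 r$, $0\le\varsigma\le s$; (7) $\llbracket\mathrm m_{\rho,\rho+1}\alpha,\beta\rrbracket^{(r-1,s)}=\mathrm m_{\rho,\rho+1}\llbracket\alpha,\beta\rrbracket^{(r,s)}$, $\llbracket\alpha,\mathrm m_{\varsigma,\varsigma+1}\beta\rrbracket^{(r,s-1)}=\mathrm m_{r+\varsigma,r+\varsigma+1}\llbracket\alpha,\beta\rrbracket^{(r,s)}$ for $1\le\rho\le r-1$, $1\le\varsigma\le s-1$; (8) for $m_1+\dots+m_\ell=s$ ($m_i>0$), $\sigma\in S_\ell$, $\widehat\sigma=\mathrm{id}_1\times\sigma$: $\llbracket\alpha,\tau_\sigma^{m_1,\dots,m_\ell}\beta\rrbracket^{(r,s)}=\tau_{\widehat\sigma}^{r,m_1,\dots,m_\ell}\llbracket\alpha,\beta\rrbracket^{(r,s)}$, $\llbracket\tau_\sigma^{m_1,\dots,m_\ell}\beta,\alpha\rrbracket^{(s,r)}=\tau_\sigma^{m_1,\dots,m_\ell}\llbracket\beta,\alpha\rrbracket^{(s,r)}$.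
   Formalization: The axiom ⟦π(α),β⟧=π⟦α,β⟧ is required only for |α|≥1; imposed also for |α|=0, where π=0, it would force δ=0, and the converse would fail for A=k[x], D=d/dx. *)

(* Defs.v *)
From HB Require Import structures.
From mathcomp Require Import all_boot all_order all_algebra all_fingroup.
From mathcomp Require Import sesquilinear finmap boolp monalg.

Set Implicit Arguments.
Unset Strict Implicit.
Unset Printing Implicit Defensive.

Import GRing.Theory.
Local Open Scope ring_scope.
Local Open Scope quotient_scope.

Section Quotient.
Variables (k : fieldType) (V : lmodType k) (R : V -> Prop).

Inductive span : V -> Prop :=
| span0 : span 0
| spanS c r v : R r -> span v -> span (c *: r + v).

Lemma spanD u v : span u -> span v -> span (u + v).
Proof.
move=> su sv; elim: su => [|c r w Rr _ IH]; first by rewrite add0r.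
by rewrite -addrA; apply: spanS.
Qed.

Lemma spanZ c v : span v -> span (c *: v).
Proof.
elim=> [|d r w Rr _ IH]; first by rewrite scaler0; exact: span0.
by rewrite scalerDr scalerA; apply: spanS.
Qed.

Definition spanb : {pred V} := fun v => `[< span v >].

Lemma spanb_closed : zmod_closed spanb.
Proof.
split=> [|u v /asboolP su /asboolP sv]; apply/asboolP; first exact: span0.
by apply: spanD => //; rewrite -scaleN1r; apply: spanZ.
Qed.
HB.instance Definition _ := GRing.isZmodClosed.Build V spanb spanb_closed.

Definition quotmod : Type := Quotient.quot spanb.
HB.instance Definition _ := GRing.Zmodule.on quotmod.
HB.instance Definition _ := EqQuotient.on quotmod.
End Quotient.

(* proj, quot_repr, flift and gen are locked so that conversion never unfolds
   the representatives, which come from classical choice. *)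
HB.lock Definition proj (k : fieldType) (V : lmodType k) (R : V -> Prop)
  (v : V) : quotmod R := \pi_(Quotient.quot (spanb R)) v.

HB.lock Definition quot_repr (k : fieldType) (V : lmodType k) (R : V -> Prop)
  (x : quotmod R) : V := generic_quotient.repr x.

Section QuotientTheory.
Variables (k : fieldType) (V : lmodType k) (R : V -> Prop).
Local Notation quotmod := (@quotmod k V R).
Local Notation span := (@span k V R).
Local Notation spanb := (@spanb k V R).
Local Notation proj := (@proj k V R).

Lemma projP u v : (proj u = proj v) <-> span (u - v).
Proof.
rewrite proj.unlock; split=> [e|s].
  apply/asboolP; suff: (u - v) \in spanb by [].
  by rewrite Quotient.idealrBE; apply/eqP.
by apply/eqP; rewrite -Quotient.idealrBE; apply/asboolP.
Qed.

Lemma proj_repr (x : quotmod) : proj (quot_repr x) = x.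
Proof. by rewrite proj.unlock quot_repr.unlock; exact: reprK. Qed.

Lemma projB : {morph proj : u v / u - v}.
Proof. by move=> u v; rewrite proj.unlock !piE. Qed.
HB.instance Definition _ := GRing.isZmodMorphism.Build V quotmod proj projB.

Definition qscale (c : k) (x : quotmod) : quotmod := proj (c *: quot_repr x).

Lemma qscaleE c v : qscale c (proj v) = proj (c *: v).
Proof.
apply/projP; rewrite -scalerBr; apply: spanZ; apply/projP.
exact: proj_repr.
Qed.

Fact qscaleA a b x : qscale a (qscale b x) = qscale (a * b) x.
Proof. by rewrite -[x]proj_repr !qscaleE scalerA. Qed.
Fact qscale1 : left_id 1 qscale.
Proof. by move=> x; rewrite -[x]proj_repr qscaleE scale1r. Qed.
Fact qscaleDr : right_distributive qscale +%R.
Proof.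
move=> c x y; rewrite -[x]proj_repr -[y]proj_repr -raddfD !qscaleE -raddfD /=.
by rewrite scalerDr.
Qed.
Fact qscaleDl x : {morph qscale^~ x : a b / a + b}.
Proof.
by move=> a b; rewrite -[x]proj_repr !qscaleE -raddfD scalerDl.
Qed.
HB.instance Definition _ :=
  GRing.Zmodule_isLmodule.Build k quotmod qscaleA qscale1 qscaleDr qscaleDl.

Lemma projZ : scalable proj.
Proof. by move=> c v; rewrite -qscaleE. Qed.
HB.instance Definition _ := GRing.isScalable.Build k V quotmod *:%R proj projZ.

Definition qlift (W : Type) (f : V -> W) (x : quotmod) : W := f (quot_repr x).

Section Lift.
Variables (W : lmodType k) (f : V -> W).
Hypotheses (fL : linear f) (fR : forall r, R r -> f r = 0).

Let f0 : f 0 = 0.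
Proof. by have := fL (-1) 0 0; rewrite scaleN1r oppr0 addr0 scaleN1r addNr. Qed.

Let f_span v : span v -> f v = 0.
Proof. by elim=> [//|c r w Rr _ IH]; rewrite fL IH fR // scaler0 addr0. Qed.

Lemma qliftE v : qlift f (proj v) = f v.
Proof.
have /projP/f_span := proj_repr (proj v).
by rewrite -[X in X - v]scale1r -scaleN1r addrC fL addrC scale1r scaleN1r => /subr0_eq.
Qed.

Lemma qlift_linear : linear (qlift f).
Proof.
move=> c x y; rewrite -[x]proj_repr -[y]proj_repr -linearP !qliftE.
exact: fL.
Qed.
End Lift.
End QuotientTheory.

HB.lock Definition flift (k : fieldType) (X : choiceType) (W : lmodType k)
  (f : X -> W) (g : {malg k[X]}) : W := \sum_(x <- msupp g) g@_x *: f x.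

HB.lock Definition gen (k : fieldType) (X : choiceType) (R : {malg k[X]} -> Prop)
  (x : X) : quotmod R := proj R << x >>.

Section Presentation.
Variables (k : fieldType) (X : choiceType).

Lemma fliftEw (W : lmodType k) (f : X -> W) (g : {malg k[X]}) (d : {fset X}) :
  (msupp g `<=` d)%fset -> flift f g = \sum_(x <- d) g@_x *: f x.
Proof.
move=> le; rewrite flift.unlock; apply/big_fset_incl => // x _ xg.
by rewrite mcoeff_outdom // scale0r.
Qed.

Lemma flift_linear (W : lmodType k) (f : X -> W) : linear (flift f).
Proof.
move=> c g h; pose d := (msupp (c *: g + h) `|` msupp g `|` msupp h)%fset.
rewrite !(@fliftEw _ f _ d); first last.
- by rewrite /d -fsetUA fsubsetUl.
- by rewrite /d fsetUAC fsubsetUr.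
- by rewrite /d fsubsetUr.
rewrite scaler_sumr -big_split /=; apply: eq_bigr => x _.
by rewrite mcoeffD mcoeffZ scalerDl scalerA.
Qed.
HB.instance Definition _ (W : lmodType k) (f : X -> W) :=
  GRing.isLinear.Build k {malg k[X]} W *:%R (flift f) (flift_linear f).

Lemma fliftE (W : lmodType k) (f : X -> W) x : flift f << x >> = f x.
Proof.
rewrite (@fliftEw _ f _ [fset x]%fset) ?msuppU_le //.
by rewrite big_seq_fset1 mcoeffUU scale1r.
Qed.

Lemma malg_ind (P : {malg k[X]} -> Prop) :
  P 0 -> (forall c x g, P g -> P (c *: << x >> + g)) -> forall g, P g.
Proof.
move=> P0 PS g; rewrite [g]monalgE.
elim: (enum_fset _) => [|x s IH]; first by rewrite big_nil.
rewrite big_cons.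
have -> : << g@_x *g x >> = g@_x *: << x >> :> {malg k[X]}.
  by apply/malgP => y; rewrite mcoeffZ !mcoeffU mulr_natr.
exact: PS.
Qed.

Variable R : {malg k[X]} -> Prop.

Definition plift (W : lmodType k) (f : X -> W) : quotmod R -> W :=
  qlift (flift f).

Local Notation gen := (@gen k X R).

Lemma gen_ind (P : quotmod R -> Prop) :
  P 0 -> (forall c x v, P v -> P (c *: gen x + v)) -> forall v, P v.
Proof.
move=> P0 PS v; rewrite -(proj_repr v).
elim/malg_ind: (quot_repr v) => [|c x g IH]; first by rewrite raddf0.
by rewrite linearP /= -[proj R _]/(proj R _); have := PS c x _ IH; rewrite gen.unlock.
Qed.

Section Lift.
Variables (W : lmodType k) (f : X -> W).
Hypothesis fR : forall r, R r -> flift f r = 0.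

Lemma pliftE x : plift f (gen x) = f x.
Proof. by rewrite gen.unlock /plift qliftE ?fliftE //; apply: flift_linear. Qed.

Lemma plift_linear : linear (plift f).
Proof. by apply: qlift_linear => //; apply: flift_linear. Qed.
End Lift.
End Presentation.

Section Tensor.
Variables (k : fieldType) (U V : lmodType k).

Inductive tensor_rel : {malg k[(U * V)%type]} -> Prop :=
| tensor_rel_l c u u' v :
    tensor_rel (<< (c *: u + u', v) >> - (c *: << (u, v) >> + << (u', v) >>))
| tensor_rel_r c u v v' :
    tensor_rel (<< (u, c *: v + v') >> - (c *: << (u, v) >> + << (u, v') >>)).

Definition tensor : Type := quotmod tensor_rel.
HB.instance Definition _ := GRing.Lmodule.on tensor.

Definition tens (u : U) (v : V) : tensor := gen tensor_rel (u, v).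

(* Meaningful only for bilinear f, see tens_liftE; likewise for the other
   lifts below. *)
Definition tens_lift (W : lmodType k) (f : U -> V -> W) : tensor -> W :=
  plift (fun p => f p.1 p.2).

Lemma tens_bilinear : bilinear_for *:%R *:%R tens.
Proof.
split=> [v c u u'|u c v v']; rewrite /tens gen.unlock -linearP; apply/projP;
  rewrite -[X in span _ X]addr0 -[X in span _ (X + _)]scale1r;
  apply: spanS; [exact: tensor_rel_l | exact: span0 | exact: tensor_rel_r | exact: span0].
Qed.

Lemma tensDl u u' v : tens (u + u') v = tens u v + tens u' v.
Proof. by have := tens_bilinear.1 v 1 u u'; rewrite /= !scale1r. Qed.

Lemma tensDr u v v' : tens u (v + v') = tens u v + tens u v'.
Proof. by have := tens_bilinear.2 u 1 v v'; rewrite /= !scale1r. Qed.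

Lemma tens0l v : tens 0 v = 0.
Proof. by apply: (@addrI _ (tens 0 v)); rewrite -tensDl !addr0. Qed.

Lemma tens0r u : tens u 0 = 0.
Proof. by apply: (@addrI _ (tens u 0)); rewrite -tensDr !addr0. Qed.

Lemma tensZl c u v : tens (c *: u) v = c *: tens u v.
Proof. by have := tens_bilinear.1 v c u 0; rewrite /= tens0l !addr0. Qed.

Lemma tensZr c u v : tens u (c *: v) = c *: tens u v.
Proof. by have := tens_bilinear.2 u c v 0; rewrite /= tens0r !addr0. Qed.

Lemma tens_ind (P : tensor -> Prop) :
  P 0 -> (forall u v x, P x -> P (tens u v + x)) -> forall x, P x.
Proof.
move=> P0 PS; apply: gen_ind => // c [u v] x Px.
by rewrite -/(tens u v) -tensZl; apply: PS.
Qed.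

Section Lift.
Variables (W : lmodType k) (f : U -> V -> W).
Hypothesis fL : bilinear_for *:%R *:%R f.

Let fR r : tensor_rel r -> flift (fun p => f p.1 p.2) r = 0.
Proof.
case=> [c u u' v|c u v v']; rewrite linearB linearP /= !fliftE /=.
- by have /= -> := fL.1 v c u u'; rewrite subrr.
- by have /= -> := fL.2 u c v v'; rewrite subrr.
Qed.

Lemma tens_liftE u v : tens_lift f (tens u v) = f u v.
Proof. exact: (pliftE fR). Qed.

Lemma tens_lift_linear : linear (tens_lift f).
Proof. exact: plift_linear. Qed.
End Lift.
End Tensor.

Section LiftTheory.
Variables (k : fieldType) (X : choiceType) (R : {malg k[X]} -> Prop).
Variables (W : lmodType k).

Lemma eq_flift (f g : X -> W) : f =1 g -> flift f =1 flift g.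
Proof. by move=> fg x; rewrite flift.unlock; apply: eq_bigr => y _; rewrite fg. Qed.

Lemma flift_fun (f g : X -> W) c x :
  flift (fun y => c *: f y + g y) x = c *: flift f x + flift g x.
Proof.
rewrite flift.unlock scaler_sumr -big_split /=.
by apply: eq_bigr => y _; rewrite scalerDr !scalerA mulrC.
Qed.

Lemma eq_plift (f g : X -> W) : f =1 g -> plift (R := R) f =1 plift g.
Proof. by move=> fg x; exact: eq_flift. Qed.

Lemma plift_fun (f g : X -> W) c x :
  plift (R := R) (fun y => c *: f y + g y) x = c *: plift f x + plift g x.
Proof. exact: flift_fun. Qed.
End LiftTheory.

Section TensorPower.
Variables (k : fieldType) (V : lmodType k) (n : nat).

Definition upd (a : {ffun 'I_n -> V}) (i : 'I_n) (b : V) : {ffun 'I_n -> V} :=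
  [ffun j => if j == i then b else a j].

Definition multilinear (W : lmodType k) (f : {ffun 'I_n -> V} -> W) : Prop :=
  forall a i, linear (fun b => f (upd a i b)).

Inductive tpow_rel : {malg k[{ffun 'I_n -> V}]} -> Prop :=
| tpow_relP a i c b b' :
    tpow_rel (<< upd a i (c *: b + b') >>
              - (c *: << upd a i b >> + << upd a i b' >>)).

Definition tpow : Type := quotmod tpow_rel.
HB.instance Definition _ := GRing.Lmodule.on tpow.

(* The tensor a 0 (x) ... (x) a (n - 1). *)
Definition ptens (a : {ffun 'I_n -> V}) : tpow := gen tpow_rel a.

Definition ptens_lift (W : lmodType k) (f : {ffun 'I_n -> V} -> W) : tpow -> W :=
  plift f.

Lemma updE (a : {ffun 'I_n -> V}) i : upd a i (a i) = a.
Proof. by apply/ffunP => j; rewrite ffunE; case: eqP => // ->. Qed.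

Lemma ptens_multilinear : multilinear ptens.
Proof.
move=> a i c b b'; rewrite /ptens gen.unlock -linearP; apply/projP.
rewrite -[X in span _ X]addr0 -[X in span _ (X + _)]scale1r.
by apply: spanS; [exact: tpow_relP | exact: span0].
Qed.

Section Lift.
Variables (W : lmodType k) (f : {ffun 'I_n -> V} -> W).
Hypothesis fL : multilinear f.

Let fR r : tpow_rel r -> flift f r = 0.
Proof.
case=> a i c b b'; rewrite linearB linearP /= !fliftE.
by rewrite (fL a i c b b') subrr.
Qed.

Lemma ptens_liftE a : ptens_lift f (ptens a) = f a.
Proof. exact: (pliftE fR). Qed.

Lemma ptens_lift_linear : linear (ptens_lift f).
Proof. exact: plift_linear. Qed.
End Lift.

Lemma ptens_eq (W : lmodType k) (f g : tpow -> W) :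
  linear f -> linear g -> (forall a, f (ptens a) = g (ptens a)) -> f =1 g.
Proof.
move=> fL gL e x; elim/gen_ind: x => [|c a v IH]; last by rewrite fL gL e IH.
have := fL (-1) 0 0; have := gL (-1) 0 0.
by rewrite !scaleN1r !addNr => -> ->.
Qed.
End TensorPower.

Section SymmetricAlgebra.
Variables (k : fieldType) (V : lmodType k).

(* The basis element << s >> stands for the product of the entries of s. *)
Inductive sym_rel : {malg k[seq V]} -> Prop :=
| sym_rel_perm s t : perm_eq s t -> sym_rel (<< s >> - << t >>)
| sym_rel_lin c u v s :
    sym_rel (<< (c *: u + v) :: s >> - (c *: << u :: s >> + << v :: s >>)).

Definition symalg : Type := quotmod sym_rel.
HB.instance Definition _ := GRing.Lmodule.on symalg.

Definition symm (s : seq V) : symalg := gen sym_rel s.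

Lemma symm_perm s t : perm_eq s t -> symm s = symm t.
Proof.
move=> st; rewrite /symm gen.unlock; apply/projP; rewrite -[X in span _ X]addr0 -[X in span _ (X + _)]scale1r.
by apply: spanS; [exact: sym_rel_perm | exact: span0].
Qed.

Lemma symm_lin c u v s :
  symm ((c *: u + v) :: s) = c *: symm (u :: s) + symm (v :: s).
Proof.
rewrite /symm gen.unlock -linearP; apply/projP.
rewrite -[X in span _ X]addr0 -[X in span _ (X + _)]scale1r.
by apply: spanS; [exact: sym_rel_lin | exact: span0].
Qed.

Section Lift.
Variables (W : lmodType k) (f : seq V -> W).
Hypothesis f_perm : forall s t, perm_eq s t -> f s = f t.
Hypothesis f_lin : forall s, linear (fun u => f (u :: s)).

Let fR r : sym_rel r -> flift f r = 0.
Proof.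
case=> [s t st|c u v s]; rewrite linearB /=.
  by rewrite !fliftE (f_perm st) subrr.
by rewrite linearP /= !fliftE (f_lin s c u v) subrr.
Qed.

Lemma sym_liftE s : plift f (symm s) = f s.
Proof. exact: (pliftE fR). Qed.

Lemma sym_lift_linear : linear (plift (R := sym_rel) f).
Proof. exact: plift_linear. Qed.
End Lift.

Definition sym_one : symalg := symm [::].
Definition sym_mul (x y : symalg) : symalg :=
  plift (fun s => plift (fun t => symm (s ++ t)) y) x.

Let inner_perm s t t' : perm_eq t t' -> symm (s ++ t) = symm (s ++ t').
Proof. by move=> tt'; apply: symm_perm; rewrite perm_cat2l. Qed.

Let inner_lin s t : linear (fun u => symm (s ++ u :: t)).
Proof.
have e u : symm (s ++ u :: t) = symm (u :: s ++ t).
  by apply/symm_perm/permPl; exact: (perm_catCA s [:: u] t).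
by move=> c u v; rewrite !e symm_lin.
Qed.

Let outer_perm y s s' : perm_eq s s' ->
  plift (R := sym_rel) (fun t => symm (s ++ t)) y
  = plift (fun t => symm (s' ++ t)) y.
Proof.
by move=> ss'; apply: eq_plift => t; apply: symm_perm; rewrite perm_cat2r.
Qed.

Let outer_lin y s :
  linear (fun u => plift (R := sym_rel) (fun t => symm ((u :: s) ++ t)) y).
Proof.
move=> c u v; rewrite -plift_fun; apply: eq_plift => t /=.
exact: symm_lin.
Qed.

Lemma sym_mulE s t : sym_mul (symm s) (symm t) = symm (s ++ t).
Proof.
rewrite /sym_mul sym_liftE; [|exact: outer_perm|exact: outer_lin].
by rewrite sym_liftE; [|exact: inner_perm|exact: inner_lin].
Qed.

Lemma sym_mulPl c x x' y :
  sym_mul (c *: x + x') y = c *: sym_mul x y + sym_mul x' y.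
Proof.
by rewrite /sym_mul sym_lift_linear; [|exact: outer_perm|exact: outer_lin].
Qed.

Lemma sym_mulPr c x y z :
  sym_mul x (c *: y + z) = c *: sym_mul x y + sym_mul x z.
Proof.
rewrite /sym_mul -plift_fun; apply: eq_plift => s.
by apply: sym_lift_linear; [exact: inner_perm|exact: inner_lin].
Qed.

Let mul0 y : sym_mul 0 y = 0.
Proof. by have := sym_mulPl (-1) 0 0 y; rewrite !scaleN1r !addNr. Qed.

Let mulx0 x : sym_mul x 0 = 0.
Proof. by have := sym_mulPr (-1) x 0 0; rewrite !scaleN1r !addNr. Qed.

Lemma sym_ind (P : symalg -> Prop) :
  P 0 -> (forall c s x, P x -> P (c *: symm s + x)) -> forall x, P x.
Proof. by move=> P0 PS; apply: gen_ind. Qed.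

Lemma sym_mulC : commutative sym_mul.
Proof.
move=> x y; elim/sym_ind: x => [|c s x IH]; first by rewrite mul0 mulx0.
rewrite (sym_mulPl c _ x y) (sym_mulPr c y _ x) IH.
suff -> : sym_mul (symm s) y = sym_mul y (symm s) by [].
elim/sym_ind: y {IH} => [|d t y IHy]; first by rewrite mul0 mulx0.
rewrite (sym_mulPl d _ y _) (sym_mulPr d _ _ y) IHy !sym_mulE.
have /symm_perm -> // : perm_eq (s ++ t) (t ++ s) by rewrite perm_catC.
Qed.

Lemma sym_mulA : associative sym_mul.
Proof.
move=> x y z; elim/sym_ind: x => [|c s x IH]; first by rewrite !mul0.
rewrite (sym_mulPl c _ x y) !(sym_mulPl c _ _ _) IH.
suff -> : sym_mul (symm s) (sym_mul y z) = sym_mul (sym_mul (symm s) y) z by [].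
elim/sym_ind: y {IH} => [|d t y IHy]; first by rewrite mul0 mulx0 mul0.
rewrite (sym_mulPl d _ y z) !(sym_mulPr d (symm s)) (sym_mulPl d _ _ z) IHy.
suff -> : sym_mul (symm s) (sym_mul (symm t) z)
        = sym_mul (sym_mul (symm s) (symm t)) z by [].
elim/sym_ind: z {IHy} => [|e r z IHz]; first by rewrite !mulx0.
rewrite (sym_mulPr e (symm t)) (sym_mulPr e (symm s)).
rewrite (sym_mulPr e (sym_mul (symm s) (symm t)) (symm r) z).
by rewrite IHz !sym_mulE catA.
Qed.

Lemma sym_mul1 : left_id sym_one sym_mul.
Proof.
move=> x; elim/sym_ind: x => [|c s x IH]; first by rewrite mulx0.
by rewrite (sym_mulPr c sym_one _ x) IH sym_mulE.
Qed.

Lemma sym_mulDl : left_distributive sym_mul +%R.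
Proof.
by move=> x y z; have := sym_mulPl 1 x y z; rewrite !scale1r.
Qed.

Lemma sym_one_neq0 : sym_one != 0.
Proof.
pose f (s : seq V) : k^o := (nilp s)%:R.
have fP s t : perm_eq s t -> f s = f t.
  by move/perm_size => st; rewrite /f /nilp st.
have fL s : linear (fun u => f (u :: s)).
  by move=> c u v; rewrite /f /= scaler0 addr0.
have e := sym_lift_linear fP fL (-1) 0 0.
apply/eqP => o0; have := sym_liftE fP fL [::]; rewrite -/sym_one o0.
move: e; rewrite !scaleN1r !addNr => -> /esym/eqP.
by rewrite /f oner_eq0.
Qed.

HB.instance Definition _ := GRing.Zmodule_isComNzRing.Build symalg
  sym_mulA sym_mulC sym_mul1 sym_mulDl sym_one_neq0.

Lemma sym_scaleAl c (x y : symalg) : c *: (x * y) = (c *: x) * y.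
Proof.
by have := sym_mulPl c x 0 y; rewrite mul0 !addr0 => /esym.
Qed.
HB.instance Definition _ := GRing.Lmodule_isLalgebra.Build k symalg sym_scaleAl.
HB.instance Definition _ := GRing.Lalgebra_isComAlgebra.Build k symalg.

Definition sym_gen (v : V) : symalg := symm [:: v].

Lemma symmE s : symm s = \prod_(v <- s) sym_gen v.
Proof.
elim: s => [|v s IH]; first by rewrite big_nil.
by rewrite big_cons -IH -[RHS]/(sym_mul (symm [:: v]) (symm s)) sym_mulE.
Qed.
End SymmetricAlgebra.

Section Permutations.
Local Open Scope nat_scope.

Definition pcat_fun n m (u : 'S_n) (v : 'S_m) (i : 'I_(n + m)) : 'I_(n + m) :=
  match split i with
  | inl j => lshift m (u j)
  | inr j => rshift n (v j)
  end.

Fact pcat_inj n m (u : 'S_n) (v : 'S_m) : injective (pcat_fun u v).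
Proof.
move=> i j; rewrite /pcat_fun -{2}(splitK i) -{2}(splitK j).
case: (split i) (split j) => [i'|i'] [j'|j'] /= /eqP.
- by rewrite eq_lshift => /eqP /perm_inj ->.
- by rewrite eq_lrshift.
- by rewrite eq_rlshift.
- by rewrite eq_rshift => /eqP /perm_inj ->.
Qed.

Definition pcat n m (u : 'S_n) (v : 'S_m) : 'S_(n + m) := perm (@pcat_inj n m u v).

(* u_*; letters are numbered from 0, so that j + 1 becomes lift ord0 j and the
   letter 1 becomes ord0. The default value of odflt is never used. *)
Definition pstar_fun n (u : 'S_n.+1) (j : 'I_n) : 'I_n :=
  let i := lift ord0 j in
  odflt j (unlift ord0 (if u i != ord0 then u i else u (u i))).

Lemma pstar_funE n (u : 'S_n.+1) (j : 'I_n) :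
  let i := lift ord0 j in
  lift ord0 (pstar_fun u j) = if u i != ord0 then u i else u (u i).
Proof.
rewrite /= /pstar_fun; case: ifPn => [ui|/negPn/eqP ui].
  by case: unliftP => [j' -> //|e]; rewrite e eqxx in ui.
rewrite ui; case: unliftP => [j' -> //|e].
by have /perm_inj := etrans ui (esym e).
Qed.

Fact pstar_inj n (u : 'S_n.+1) : injective (pstar_fun u).
Proof.
move=> i j e; have := pstar_funE u i; have := pstar_funE u j.
rewrite /= e => ->; case: ifPn => [uj|/negPn/eqP uj]; case: ifPn => [ui|/negPn/eqP ui].
- by move/perm_inj/lift_inj.
- by rewrite ui => /perm_inj.
- by rewrite uj => /perm_inj.
- by move=> _; apply: (@lift_inj _ ord0); apply: (@perm_inj _ u); rewrite ui uj.
Qed.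

Definition pstar n (u : 'S_n.+1) : 'S_n := perm (@pstar_inj n u).

Section Blocks.
Variables (l : nat) (tau : 'S_l) (d : l.-tuple nat).

(* Blocks are consecutive intervals of lengths d_0, ..., d_(l - 1); block i
   starts at old_start i and is moved to start at new_start i. *)
Definition old_start (i : 'I_l) : nat := \sum_(j < l | j < i) tnth d j.
Definition new_start (i : 'I_l) : nat := \sum_(j < l | tau j < tau i) tnth d j.
Definition in_block (p : nat) (i : 'I_l) : bool :=
  (old_start i <= p < old_start i + tnth d i)%N.

Definition block_fun (p : nat) : nat :=
  if [pick i | in_block p i] is Some i
  then (new_start i + (p - old_start i))%N else p.

(* tau^{d_0, ..., d_(l - 1)}, extended to 'I_N by fixing the last letters.
   It is only used for \sum_i d_i <= N, where bpermE holds. *)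
Definition bperm (N : nat) : 'S_N :=
  insubd (1%g : 'S_N) [ffun p : 'I_N => insubd p (block_fun p)].

Let total : nat := \sum_(j < l) tnth d j.

Lemma start_lt (s : 'S_l) i j : (s i < s j)%N ->
  (\sum_(h < l | s h < s i) tnth d h + tnth d i
   <= \sum_(h < l | s h < s j) tnth d h)%N.
Proof.
move=> ij; rewrite [X in (_ <= X)%N](bigD1 i) //= addnC leq_add2l.
rewrite big_mkcond [X in (_ <= X)%N]big_mkcond; apply: leq_sum => h _.
case: ifP => // hi; rewrite (ltn_trans hi ij) /=.
by have [e|//] := eqVneq h i; rewrite e ltnn in hi.
Qed.

Lemma start_total (s : 'S_l) i :
  (\sum_(h < l | s h < s i) tnth d h + tnth d i <= total)%N.
Proof.
rewrite /total [X in (_ <= X)%N](bigD1 i) //= addnC leq_add2l.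
rewrite big_mkcond [X in (_ <= X)%N]big_mkcond; apply: leq_sum => h _.
by case: ifP => // hi; have [e|//] := eqVneq h i; rewrite e ltnn in hi.
Qed.

Lemma start_inj (s : 'S_l) i j (o o' : nat) :
  (o < tnth d i)%N -> (o' < tnth d j)%N ->
  (\sum_(h < l | s h < s i) tnth d h + o
   = \sum_(h < l | s h < s j) tnth d h + o')%N -> i = j.
Proof.
move=> oi oj e; apply: (@perm_inj _ s); apply/val_inj/eqP.
rewrite /= eqn_leq; apply/andP; split; rewrite leqNgt; apply/negP => /start_lt le.
  have := leq_trans le (leq_addr o _); rewrite e leq_add2l.
  by rewrite leqNgt oj.
have := leq_trans le (leq_addr o' _); rewrite -e leq_add2l.
by rewrite leqNgt oi.
Qed.

Lemma old_startE i : old_start i = \sum_(h < l | (1%g : 'S_l) h < (1%g : 'S_l) i) tnth d h.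
Proof. by apply: eq_bigl => j; rewrite !perm1. Qed.

Lemma block_funE i o : (o < tnth d i)%N ->
  block_fun (old_start i + o) = (new_start i + o)%N.
Proof.
move=> oi; rewrite /block_fun; case: pickP => [j /andP[le lt]|/(_ i)].
  have e : j = i.
    apply: (@start_inj 1%g _ _ (old_start i + o - old_start j) o) => //.
      by rewrite ltn_subLR.
    by rewrite -!old_startE subnKC.
  by rewrite e addKn.
by rewrite /in_block leq_addr ltn_add2l oi.
Qed.

Lemma block_fun_out p : (total <= p)%N -> block_fun p = p.
Proof.
move=> tp; rewrite /block_fun; case: pickP => // i /andP[_ lt].
have := start_total 1%g i; rewrite -old_startE => le.
by have := leq_trans lt (leq_trans le tp); rewrite ltnn.
Qed.

Lemma block_ex p : (p < total)%N ->
  exists i, exists2 o, (o < tnth d i)%N & p = (old_start i + o)%N.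
Proof.
move=> pt.
pose S n := (\sum_(j < l | j < n) tnth d j)%N.
have Sl : S l = total by apply: eq_bigl => j; rewrite ltn_ord.
have S0 : S 0 = 0%N by rewrite /S big_pred0.
have ex : exists n, (p < S n)%N by exists l; rewrite Sl.
case: (ex_minnP ex) => -[|n] pn minn; first by rewrite S0 in pn.
have nl : (n < l)%N.
  rewrite ltnNge; apply/negP => ln; have := minn l; rewrite Sl pt => /(_ isT).
  by rewrite ltnNge ln.
have Sn : S n.+1 = (old_start (Ordinal nl) + tnth d (Ordinal nl))%N.
  rewrite /S (bigD1 (Ordinal nl)) //= addnC; congr addn; apply: eq_bigl => j /=.
  rewrite ltnS -val_eqE /= (ltn_neqAle j n) andbC.
  by [].
have le : (old_start (Ordinal nl) <= p)%N.
  by rewrite leqNgt; apply/negP => /minn; rewrite ltnn.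
exists (Ordinal nl), (p - old_start (Ordinal nl))%N; last by rewrite subnKC.
by rewrite ltn_subLR // -Sn.
Qed.

Lemma bpermE N (p : 'I_N) : (total <= N)%N -> bperm N p = block_fun p :> nat.
Proof.
move=> tN.
have lt q : (q < total)%N -> (block_fun q < total)%N.
  case/block_ex => i [o oi ->]; rewrite block_funE //.
  by apply: leq_trans (start_total tau i); rewrite ltn_add2l.
have ltN (q : 'I_N) : (block_fun q < N)%N.
  have [/lt qt|tq] := ltnP q total; first exact: leq_trans qt tN.
  by rewrite block_fun_out.
have inj : injective block_fun.
  move=> q q'; have [qt|tq] := ltnP q total; have [qt'|tq'] := ltnP q' total.
  - have [i [o oi ->]] := block_ex qt; have [j [o' oj ->]] := block_ex qt'.
    rewrite !block_funE // => e; have ij := start_inj oi oj e; move: e.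
    by rewrite -ij => /addnI ->.
  - by rewrite (block_fun_out tq') => e; have := lt _ qt; rewrite e ltnNge tq'.
  - by rewrite (block_fun_out tq) => e; have := lt _ qt'; rewrite -e ltnNge tq.
  - by rewrite !block_fun_out.
have vE (q : 'I_N) : insubd q (block_fun q) = block_fun q :> nat.
  by rewrite val_insubd ltN.
rewrite /bperm -pvalE -[pval _]/(val _) val_insubd ifT ?ffunE ?vE //.
apply/injectiveP => q q'; rewrite !ffunE => /(congr1 val) /=.
by rewrite !vE => /inj /val_inj.
Qed.
End Blocks.

Definition s12 : 'S_2 := tperm ord0 ord_max.
(* ordS and ord_pred are i |-> i + 1 and i |-> i - 1 modulo 3. *)
Definition s123 : 'S_3 := perm (@ordS_inj 3).
Definition s132 : 'S_3 := perm (@ord_pred_inj 3).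
Definition s23 : 'S_3 := tperm (inord 1) (inord 2).

End Permutations.

Section TensorOperations.
Variables (k : fieldType) (A : algType k).

Definition fcat n m (a : {ffun 'I_n -> A}) (b : {ffun 'I_m -> A}) :
    {ffun 'I_(n + m) -> A} :=
  [ffun i => match split i with inl j => a j | inr j => b j end].

Definition tcat n m (x : tpow A n) (y : tpow A m) : tpow A (n + m) :=
  ptens_lift (fun a => ptens_lift (fun b => ptens (fcat a b)) y) x.

(* sigma(a) has a_j in position sigma(j). *)
Definition fact n (s : 'S_n) (a : {ffun 'I_n -> A}) : {ffun 'I_n -> A} :=
  [ffun i => a (s^-1%g i)].

Definition tact n (s : 'S_n) : tpow A n -> tpow A n :=
  ptens_lift (fun a => ptens (fact s a)).

(* m_{u,v}, for distinct positions u and v numbered from 0. *)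
Definition fmerge n (u v : 'I_n.+1) (a : {ffun 'I_n.+1 -> A}) : {ffun 'I_n -> A} :=
  [ffun j => if lift u j == v then a u * a v else a (lift u j)].

Definition tmerge n (u v : 'I_n.+1) : tpow A n.+1 -> tpow A n :=
  ptens_lift (fun a => ptens (fmerge u v a)).

(* The entry b gets position r, numbered from 0: it comes right after the first
   r entries of a. *)
Definition fins n (r : 'I_n.+1) (b : A) (a : {ffun 'I_n -> A}) : {ffun 'I_n.+1 -> A} :=
  [ffun i => if unlift r i is Some j then a j else b].

Definition tins n (r : 'I_n.+1) (b : A) : tpow A n -> tpow A n.+1 :=
  ptens_lift (fun a => ptens (fins r b a)).

Definition ftail n (a : {ffun 'I_n.+1 -> A}) : {ffun 'I_n -> A} :=
  [ffun j => a (lift ord0 j)].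

Definition tone0 : tpow A 0 := ptens [ffun => 1].
Definition t1 (a : A) : tpow A 1 := ptens [ffun => a].

Definition tder (D : A -> A) n : tpow A n -> tpow A n :=
  ptens_lift (fun a => \sum_(i < n) ptens (upd a i (D (a i)))).

Definition castT n m (e : n = m) (x : tpow A n) : tpow A m := ecast i (tpow A i) e x.

Lemma fcat_updl n m (a : {ffun 'I_n -> A}) (b : {ffun 'I_m -> A}) i c :
  fcat (upd a i c) b = upd (fcat a b) (lshift m i) c.
Proof.
apply/ffunP => j; rewrite !ffunE -(splitK j); case: (split j) => j' /=.
  by rewrite (unsplitK (inl j')) ffunE eq_lshift.
by rewrite (unsplitK (inr j')) eq_rlshift.
Qed.

Lemma fcat_updr n m (a : {ffun 'I_n -> A}) (b : {ffun 'I_m -> A}) i c :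
  fcat a (upd b i c) = upd (fcat a b) (rshift n i) c.
Proof.
apply/ffunP => j; rewrite !ffunE -(splitK j); case: (split j) => j' /=.
  by rewrite (unsplitK (inl j')) eq_lrshift.
by rewrite (unsplitK (inr j')) ffunE eq_rshift.
Qed.

Lemma tcat_multir n m (a : {ffun 'I_n -> A}) :
  multilinear (fun b : {ffun 'I_m -> A} => ptens (fcat a b)).
Proof. by move=> b i c x y /=; rewrite !fcat_updr ptens_multilinear. Qed.

Lemma tcat_multil n m (y : tpow A m) :
  multilinear (fun a : {ffun 'I_n -> A} => ptens_lift (fun b => ptens (fcat a b)) y).
Proof.
move=> a i c x x' /=; rewrite -plift_fun; apply: eq_plift => b.
by rewrite !fcat_updl ptens_multilinear.
Qed.

Lemma tcatE n m (a : {ffun 'I_n -> A}) (b : {ffun 'I_m -> A}) :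
  tcat (ptens a) (ptens b) = ptens (fcat a b).
Proof. by rewrite /tcat ptens_liftE ?ptens_liftE //; [exact: tcat_multir|exact: tcat_multil]. Qed.

Lemma tcat_bilinear n m : bilinear_for *:%R *:%R (@tcat n m).
Proof.
split=> [y c x x'|x c y y'].
  by rewrite /= /tcat ptens_lift_linear //; exact: tcat_multil.
rewrite /tcat -plift_fun; apply: eq_plift => a.
by rewrite ptens_lift_linear //; exact: tcat_multir.
Qed.

Lemma fact_upd n (s : 'S_n) (a : {ffun 'I_n -> A}) i c :
  fact s (upd a i c) = upd (fact s a) (s i) c.
Proof.
by apply/ffunP => j; rewrite !ffunE -(inj_eq (@perm_inj _ s)) permKV.
Qed.

Let tact_multi n (s : 'S_n) : multilinear (fun a => ptens (fact s a)).
Proof. by move=> a i c x y /=; rewrite !fact_upd ptens_multilinear. Qed.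

Lemma tactE n (s : 'S_n) a : tact s (ptens a) = ptens (fact s a).
Proof. exact: ptens_liftE. Qed.

Lemma tact_linear n (s : 'S_n) : linear (tact s).
Proof. exact: ptens_lift_linear. Qed.

Lemma fmerge_upd n (u v : 'I_n.+1) (a : {ffun 'I_n.+1 -> A}) i c : u != v ->
  fmerge u v (upd a i c) =
  match unlift u i with
  | Some j => upd (fmerge u v a) j (if i == v then a u * c else c)
  | None => if unlift u v is Some j then upd (fmerge u v a) j (c * a v)
            else fmerge u v a
  end.
Proof.
move=> uv; have vu := uv; rewrite eq_sym in vu.
case: unliftP => [j ->|->].
  apply/ffunP => h; rewrite !ffunE (inj_eq (@lift_inj _ u)) (negPf (neq_lift u j)).
  rewrite [v == _]eq_sym; have [->|hj] := eqVneq h j; first by case: (_ == v).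
  case: (eqVneq (lift u h) v) => // hv; have -> // : (lift u j == v) = false.
  by rewrite -hv (inj_eq (@lift_inj _ u)) eq_sym (negPf hj).
case: unliftP => [j e|e]; last by rewrite e eqxx in uv.
apply/ffunP => h; rewrite !ffunE eqxx e (inj_eq (@lift_inj _ u)).
rewrite [lift u j == u]eq_sym (negPf (neq_lift u j)).
rewrite [lift u h == u]eq_sym (negPf (neq_lift u h)).
by case: (h == j).
Qed.

Lemma tmerge_multi n (u v : 'I_n.+1) : u != v ->
  multilinear (fun a => ptens (fmerge u v a)).
Proof.
move=> uv a i c x y /=; rewrite !fmerge_upd //.
case: unliftP => [j _|_].
  case: ifP => _; last exact: ptens_multilinear.
  by rewrite mulrDr -scalerAr ptens_multilinear.
case: unliftP => [j _|e]; last by rewrite e eqxx in uv.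
by rewrite mulrDl -scalerAl ptens_multilinear.
Qed.

Lemma tmergeE n (u v : 'I_n.+1) a : u != v ->
  tmerge u v (ptens a) = ptens (fmerge u v a).
Proof. by move=> uv; apply: ptens_liftE; exact: tmerge_multi. Qed.

Lemma tmerge_linear n (u v : 'I_n.+1) : u != v -> linear (tmerge u v).
Proof. by move=> uv; apply: ptens_lift_linear; exact: tmerge_multi. Qed.

Lemma fins_upd n (r : 'I_n.+1) b (a : {ffun 'I_n -> A}) i c :
  fins r b (upd a i c) = upd (fins r b a) (lift r i) c.
Proof.
apply/ffunP => h; rewrite !ffunE; case: unliftP => [j ->|->].
  by rewrite ffunE (inj_eq (@lift_inj _ r)).
by rewrite (negPf (neq_lift r i)).
Qed.

Let tins_multi n (r : 'I_n.+1) b : multilinear (fun a => ptens (fins r b a)).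
Proof. by move=> a i c x y /=; rewrite !fins_upd ptens_multilinear. Qed.

Lemma tinsE n (r : 'I_n.+1) b a : tins r b (ptens a) = ptens (fins r b a).
Proof. exact: ptens_liftE. Qed.

Lemma tins_linear n (r : 'I_n.+1) b : linear (tins r b).
Proof. exact: ptens_lift_linear. Qed.

Lemma t1_linear : linear t1.
Proof.
move=> c a b; have e d : [ffun => d] = upd [ffun => 0 : A] (ord0 : 'I_1) d.
  by apply/ffunP => i; rewrite !ffunE !ord1.
by rewrite /t1 (e (c *: a + b)) (e a) (e b) ptens_multilinear.
Qed.

Lemma upd_updl n (a : {ffun 'I_n -> A}) i b c : upd (upd a i b) i c = upd a i c.
Proof. by apply/ffunP => j; rewrite !ffunE; case: eqP. Qed.

Lemma upd_updC n (a : {ffun 'I_n -> A}) i j b c : i != j ->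
  upd (upd a i b) j c = upd (upd a j c) i b.
Proof.
move=> ij; apply/ffunP => h; rewrite !ffunE.
by case: (eqVneq h j) => // ->; rewrite eq_sym (negPf ij).
Qed.

Lemma tder_multi (D : A -> A) n : linear D ->
  multilinear (fun a : {ffun 'I_n -> A} => \sum_(i < n) ptens (upd a i (D (a i)))).
Proof.
move=> DL a i c x y /=; rewrite scaler_sumr -big_split; apply: eq_bigr => j _ /=.
have [->|ij] := eqVneq j i.
  by rewrite !ffunE !eqxx !upd_updl DL ptens_multilinear.
by rewrite !ffunE (negPf ij) ![upd (upd a i _) j _]upd_updC 1?eq_sym //
  ptens_multilinear.
Qed.

Lemma tderE (D : A -> A) n (a : {ffun 'I_n -> A}) : linear D ->
  tder D (ptens a) = \sum_(i < n) ptens (upd a i (D (a i))).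
Proof. by move=> DL; apply: ptens_liftE; exact: tder_multi. Qed.

Lemma tder_linear (D : A -> A) n : linear D -> linear (@tder D n).
Proof. by move=> DL; apply: ptens_lift_linear; exact: tder_multi. Qed.
End TensorOperations.

Section DoubleCoordinateRing.
Variables (k : fieldType) (A : algType k).

Definition commutator (x : A) : Prop := exists a b, x = a * b - b * a.

Definition Anat : Type := quotmod commutator.
HB.instance Definition _ := GRing.Lmodule.on Anat.

Definition cls (a : A) : Anat := proj commutator a.

(* O(A)^(n); the group algebra k[S_n] is only used as the vector space with
   basis << u >>, u : 'S_n. *)
Definition OA (n : nat) : Type :=
  tensor (tpow A n) (tensor (symalg Anat) {malg k['S_n]}).
HB.instance Definition _ n := GRing.Lmodule.on (OA n).

Definition opure n (x : tpow A n) (f : symalg Anat) (u : 'S_n) : OA n :=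
  tens x (tens f << u >>).

Definition OA_lift n (W : lmodType k) (g : tpow A n -> symalg Anat -> 'S_n -> W) :
    OA n -> W :=
  tens_lift (fun x => tens_lift (fun f => flift (g x f))).

Section Lift.
Variables (n : nat) (W : lmodType k) (g : tpow A n -> symalg Anat -> 'S_n -> W).
Hypothesis gl : forall f u, linear (fun x => g x f u).
Hypothesis gr : forall x u, linear (fun f => g x f u).

Let inner x : bilinear_for *:%R *:%R (fun f => flift (g x f)).
Proof.
split=> [w c f f'|f c w w']; last exact: linearP.
by rewrite -flift_fun; apply: eq_flift => u; rewrite gr.
Qed.

Let outer : bilinear_for *:%R *:%R (fun x => tens_lift (fun f => flift (g x f))).
Proof.
split=> [w c x x'|x]; last exact: tens_lift_linear.
rewrite -plift_fun; apply: eq_plift => -[f p] /=.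
by rewrite -flift_fun; apply: eq_flift => u; rewrite gl.
Qed.

Lemma OA_liftE x f u : OA_lift g (opure x f u) = g x f u.
Proof. by rewrite /OA_lift !tens_liftE ?fliftE. Qed.

Lemma OA_lift_linear : linear (OA_lift g).
Proof. exact: tens_lift_linear. Qed.
End Lift.

Lemma opure_linearl n f u : linear (fun x : tpow A n => opure x f u).
Proof. by move=> c x y; rewrite /opure tensDl tensZl. Qed.

Lemma opure_linearr n (x : tpow A n) u : linear (fun f => opure x f u).
Proof.
by move=> c f g; rewrite /opure tensDl tensZl tensDr tensZr.
Qed.

Lemma OA_ind n (P : OA n -> Prop) :
  P 0 -> (forall x f u y, P y -> P (opure x f u + y)) -> forall y, P y.
Proof.
move=> P0 PS; apply: tens_ind => // x w y.
elim/tens_ind: w y => [|f p w IH] y Py; first by rewrite tens0r add0r.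
rewrite (tensDr x (tens f p) w) -addrA; move: (IH y Py) => {IH Py}.
move: (tens x w) => z1; move: (z1 + y) => z Pz.
elim/malg_ind: p => [|c u p IH]; first by rewrite !tens0r add0r.
by rewrite !tensDr -addrA !tensZr -tensZl; exact: (PS (c *: x) f u).
Qed.

Lemma OA_eq n (W : lmodType k) (f g : OA n -> W) : linear f -> linear g ->
  (forall x h u, f (opure x h u) = g (opure x h u)) -> f =1 g.
Proof.
move=> fL gL e y; elim/OA_ind: y => [|x h u y IH].
  have := fL (-1) 0 0; have := gL (-1) 0 0.
  by rewrite !scaleN1r !addNr => -> ->.
have := fL 1 (opure x h u) y; have := gL 1 (opure x h u) y.
by rewrite !scale1r => -> ->; rewrite e IH.
Qed.

Definition oone : OA 0 := opure (tone0 A) 1 1%g.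

Definition omul n m (x : OA n) (y : OA m) : OA (n + m) :=
  OA_lift (fun a f u => OA_lift (fun b g v =>
    opure (tcat a b) (f * g) (pcat u v)) y) x.

(* sigma . x . tau. Permutations compose as functions here, (sigma u tau)(j) =
   sigma (u (tau j)), which is the group product tau * u * sigma. *)
Definition oact n (s t : 'S_n) : OA n -> OA n :=
  OA_lift (fun a f u => opure (tact s a) f (t * u * s)%g).

Definition Ad n (s : 'S_n) : OA n -> OA n := oact s s^-1%g.

(* pi in degrees n >= 1; it vanishes on OA 0. *)
Definition opi n : OA n.+1 -> OA n :=
  OA_lift (fun x f u =>
    if u ord0 == ord0
    then ptens_lift (fun a =>
           opure (ptens (ftail a)) (sym_gen (cls (a ord0)) * f) (pstar u)) x
    else opure (tmerge ord0 (u ord0) x) f (pstar u)).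

Definition hat n (x : tpow A n) : OA n := opure x 1 1%g.

Definition hat1 n (x : OA n) : OA (1 + n) := omul (hat (t1 1)) x.

Definition castO n m (e : n = m) (x : OA n) : OA m := ecast i (OA i) e x.

Let omul_inner n m (a : tpow A n) f (u : 'S_n) :
  (forall g (v : 'S_m), linear (fun b : tpow A m => opure (tcat a b) (f * g) (pcat u v))) *
  (forall (b : tpow A m) (v : 'S_m), linear (fun g => opure (tcat a b) (f * g) (pcat u v))).
Proof.
split=> [g v c b b'|b v c g g'].
  by rewrite ((tcat_bilinear _ _ _).2 a c b b') opure_linearl.
by rewrite mulrDr -scalerAr opure_linearr.
Qed.

Let OA_lift_fun n (W : lmodType k) (g h : tpow A n -> symalg Anat -> 'S_n -> W) c x :
  OA_lift (fun a f u => c *: g a f u + h a f u) x = c *: OA_lift g x + OA_lift h x.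
Proof.
rewrite -plift_fun; apply: eq_plift => -[a p] /=.
rewrite -plift_fun; apply: eq_plift => -[f q] /=.
by rewrite -flift_fun.
Qed.

Let eq_OA_lift n (W : lmodType k) (g h : tpow A n -> symalg Anat -> 'S_n -> W) :
  (forall a f u, g a f u = h a f u) -> OA_lift g =1 OA_lift h.
Proof.
move=> gh x; apply: eq_plift => -[a p] /=; apply: eq_plift => -[f q] /=.
by apply: eq_flift => u.
Qed.

Let omul_outer n m (y : OA m) :
  (forall f (u : 'S_n), linear (fun a : tpow A n =>
    OA_lift (fun b g v => opure (tcat a b) (f * g) (pcat u v)) y)) *
  (forall (a : tpow A n) (u : 'S_n), linear (fun f =>
    OA_lift (fun b g v => opure (tcat a b) (f * g) (pcat u v)) y)).
Proof.
split=> [f u c a a'|a u c f f']; rewrite -OA_lift_fun; apply: eq_OA_lift => b g v.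
  by rewrite ((tcat_bilinear _ _ _).1 b c a a') opure_linearl.
by rewrite mulrDl -scalerAl opure_linearr.
Qed.

Lemma omulE n m (a : tpow A n) f (u : 'S_n) (b : tpow A m) g (v : 'S_m) :
  omul (opure a f u) (opure b g v) = opure (tcat a b) (f * g) (pcat u v).
Proof.
have [o1 o2] := @omul_outer n m (opure b g v).
have [i1 i2] := @omul_inner n m a f u.
by rewrite /omul OA_liftE // OA_liftE.
Qed.

Lemma omul_bilinear n m : bilinear_for *:%R *:%R (@omul n m).
Proof.
split=> [y|x c y y'].
  by have [o1 o2] := @omul_outer n m y; apply: OA_lift_linear.
rewrite /omul -OA_lift_fun; apply: eq_OA_lift => a f u.
by have [i1 i2] := @omul_inner n m a f u; apply: OA_lift_linear.
Qed.

Let oact_multi n (s t : 'S_n) :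
  (forall f u, linear (fun a : tpow A n => opure (tact s a) f (t * u * s)%g)) *
  (forall (a : tpow A n) u, linear (fun f => opure (tact s a) f (t * u * s)%g)).
Proof.
split=> [f u c a a'|a u]; last exact: opure_linearr.
by rewrite tact_linear opure_linearl.
Qed.

Lemma oactE n (s t : 'S_n) a f u :
  oact s t (opure a f u) = opure (tact s a) f (t * u * s)%g.
Proof. by have [m1 m2] := oact_multi s t; apply: OA_liftE. Qed.

Lemma oact_linear n (s t : 'S_n) : linear (oact s t).
Proof. by have [m1 m2] := oact_multi s t; apply: OA_lift_linear. Qed.

Let pi0_multi n f (u : 'S_n.+1) : multilinear (fun a : {ffun 'I_n.+1 -> A} =>
  opure (ptens (ftail a)) (sym_gen (cls (a ord0)) * f) (pstar u)).
Proof.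
move=> a i c x y /=.
have [->|[j ->]] : i = ord0 \/ exists j, i = lift ord0 j.
  by case: (unliftP ord0 i) => [j ->|->]; [right; exists j|left].
  have e z : ftail (upd a ord0 z) = ftail a.
    by apply/ffunP => j; rewrite !ffunE.
  rewrite !e !ffunE eqxx -opure_linearr; congr opure.
  by rewrite /cls linearP /sym_gen symm_lin mulrDl -scalerAl.
have e z : ftail (upd a (lift ord0 j) z) = upd (ftail a) j z.
  by apply/ffunP => h; rewrite !ffunE (inj_eq (@lift_inj _ ord0)).
by rewrite !e !ffunE /= ptens_multilinear opure_linearl.
Qed.

Let pi_multi n : let g (x : tpow A n.+1) f (u : 'S_n.+1) :=
    if u ord0 == ord0
    then ptens_lift (fun a =>
           opure (ptens (ftail a)) (sym_gen (cls (a ord0)) * f) (pstar u)) x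
    else opure (tmerge ord0 (u ord0) x) f (pstar u) in
  (forall f u, linear (fun x => g x f u)) * (forall x u, linear (fun f => g x f u)).
Proof.
split=> [f u c x y|x u c f f'] /=; case: ifPn => u0.
- by rewrite ptens_lift_linear //; exact: pi0_multi.
- by rewrite tmerge_linear 1?eq_sym // opure_linearl.
- rewrite -plift_fun; apply: eq_plift => a.
  by rewrite mulrDr -scalerAr opure_linearr.
- exact: opure_linearr.
Qed.

Lemma opi_linear n : linear (@opi n).
Proof. by have [m1 m2] := @pi_multi n; apply: OA_lift_linear. Qed.

Lemma opiE_fixed n a f (u : 'S_n.+1) : u ord0 = ord0 ->
  opi (opure (ptens a) f u) =
  opure (ptens (ftail a)) (sym_gen (cls (a ord0)) * f) (pstar u).
Proof.
move=> u0; have [m1 m2] := @pi_multi n; rewrite /opi OA_liftE // u0 eqxx.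
by rewrite ptens_liftE //; exact: pi0_multi.
Qed.

Lemma opiE_moved n a f (u : 'S_n.+1) : u ord0 != ord0 ->
  opi (opure (ptens a) f u) = opure (ptens (fmerge ord0 (u ord0) a)) f (pstar u).
Proof.
move=> u0; have [m1 m2] := @pi_multi n; rewrite /opi OA_liftE // (negPf u0).
by rewrite tmergeE // eq_sym.
Qed.
End DoubleCoordinateRing.

Fact addn_rot m p n : (m + (p + n) = n + (m + p))%N.
Proof. by rewrite addnA addnC. Qed.

Fact addn_rot2 p n m : (p + (n + m) = n + (m + p))%N.
Proof. by rewrite addnCA [(p + m)%N]addnC. Qed.

Fact addn_back t r s : (t + r + s = r + s + t)%N.
Proof. by rewrite -addnA addnC. Qed.

Fact addn_swap r t s : (r + (t + s) = r + s + t)%N.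
Proof. by rewrite [(t + s)%N]addnC addnA. Qed.

Section Structures.
Variables (k : fieldType) (A : algType k).

(* A bilinear operation on O(A) with values in degree n + m on
   O(A)^(n) (x) O(A)^(m), given by its homogeneous components. *)
Definition obracket := forall n m, OA A n -> OA A m -> OA A (n + m).

Record double_transposed_Poisson (br : obracket) : Prop := {
  dtp_bilinear n m : bilinear_for *:%R *:%R (@br n m);
  dtp_bimodule n m (s t : 'S_n) (s' t' : 'S_m) x y :
    br n m (oact s t x) (oact s' t' y)
    = oact (pcat s s') (pcat t t') (br n m x y);
  dtp_antisym n m (x : OA A n) (y : OA A m) :
    br m n y x
    = - castO (addnC n m) (Ad (bperm s12 [tuple n; m] (n + m)) (br n m x y));
  dtp_Jacobi n m p (x : OA A n) (y : OA A m) (z : OA A p) :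
    br n (m + p)%N x (br m p y z)
    + castO (addn_rot m p n)
        (Ad (bperm s123 [tuple m; p; n] (m + (p + n)))
          (br m (p + n)%N y (br p n z x)))
    + castO (addn_rot2 p n m)
        (Ad (bperm s132 [tuple p; n; m] (p + (n + m)))
          (br p (n + m)%N z (br n m x y)))
    = 0;
  dtp_Leibniz n m p (x : OA A n) (y : OA A m) (z : OA A p) :
    2%:R *: omul z (br n m x y)
    = castO (esym (addnA p n m)) (br (p + n)%N m (omul z x) y)
      + castO (addnCA n p m)
          (Ad (bperm s12 [tuple n; p] (n + (p + m)))
            (br n (p + m)%N x (omul z y)));
  (* Only in degrees n >= 1. On OA 0, where pi = 0, the identity would read
     pi (br 1 y) = 0 for all y; since delta = br 1 satisfies
     delta (a b) = a delta(b) + delta(a) b, it would force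
     cls a * delta(b) = 0 for all a and b. *)
  dtp_pi n m (x : OA A n.+1) (y : OA A m) :
    br n m (opi x) y = opi (br n.+1 m x y);
  dtp_hat1 n m (x : OA A n) (y : OA A m) :
    br (1 + n)%N m (hat1 x) y = hat1 (br n m x y)
}.

Definition delta (br : obracket) (a : A) : OA A 1 :=
  br 0 1 (oone A) (hat (t1 a)).

Definition restricts_to_hat (br : obracket) : Prop :=
  forall r s (x : tpow A r) (y : tpow A s),
    exists z : tpow A (r + s), br r s (hat x) (hat y) = hat z.

(* hat (t1 b) is b (x) 1 in A (x) S(A_nat) = O(A)^(1). *)
Definition delta_in_A (br : obracket) : Prop :=
  forall a, exists b, delta br a = hat (t1 b).

Definition derivation (D : A -> A) : Prop :=
  linear D /\ forall a b, D (a * b) = a * D b + D a * b.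

Definition induces_delta (br : obracket) (D : A -> A) : Prop :=
  derivation D /\ forall a, delta br a = hat (t1 (D a)).

(* Only the components with r, s >= 1 are constrained or used below. *)
Definition tbracket := forall r s, tpow A r -> tpow A s -> tpow A (r + s).

Record id_adapted (B : tbracket) : Prop := {
  ida_bilinear r s : (0 < r)%N -> (0 < s)%N -> bilinear_for *:%R *:%R (@B r s);
  ida_antisym r s (x : tpow A r) (y : tpow A s) : (0 < r)%N -> (0 < s)%N ->
    B r s x y = - castT (addnC s r) (tact (bperm s12 [tuple s; r] (s + r)) (B s r y x));
  ida_Jacobi r s t (x : tpow A r) (y : tpow A s) (z : tpow A t) :
    (0 < r)%N -> (0 < s)%N -> (0 < t)%N ->
    B r (s + t)%N x (B s t y z)
    + castT (addn_rot s t r)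
        (tact (bperm s123 [tuple s; t; r] (s + (t + r)))
          (B s (t + r)%N y (B t r z x)))
    + castT (addn_rot2 t r s)
        (tact (bperm s132 [tuple t; r; s] (t + (r + s)))
          (B t (r + s)%N z (B r s x y)))
    = 0;
  ida_Leibniz r s t (x : tpow A r) (y : tpow A s) (z : tpow A t) :
    (0 < r)%N -> (0 < s)%N -> (0 < t)%N ->
    2%:R *: tcat z (B r s x y)
    = castT (esym (addnA t r s)) (B (t + r)%N s (tcat z x) y)
      + castT (addnCA r t s)
          (tact (bperm s12 [tuple r; t] (r + (t + s)))
            (B r (t + s)%N x (tcat z y)));
  ida_Leibniz_right r s t (x : tpow A r) (y : tpow A s) (z : tpow A t) :
    (0 < r)%N -> (0 < s)%N -> (0 < t)%N ->
    2%:R *: tcat (B r s x y) z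
    = castT (addn_back t r s)
        (tact (bperm s132 [tuple t; r; s] (t + r + s))
          (B (t + r)%N s (tcat z x) y))
      + castT (addn_swap r t s)
          (tact (bperm s23 [tuple r; t; s] (r + (t + s)))
            (B r (t + s)%N x (tcat z y)));
  ida_one s (y : tpow A s) : (0 < s)%N ->
    exists z : tpow A s, B 1 s (t1 1) y = tcat (t1 1) z;
  ida_insert_left r s (x : tpow A r) (y : tpow A s) p :
    (0 < r)%N -> (0 < s)%N -> (p <= r)%N ->
    B r.+1 s (tins (inord p) 1 x) y = tins (inord p) 1 (B r s x y);
  ida_insert_right r s (x : tpow A r) (y : tpow A s) p :
    (0 < r)%N -> (0 < s)%N -> (p <= s)%N ->
    B r s.+1 x (tins (inord p) 1 y)
    = castT (esym (addnS r s)) (tins (inord (r + p)) 1 (B r s x y));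
  ida_merge_left r s (x : tpow A r.+1) (y : tpow A s) p :
    (0 < r)%N -> (0 < s)%N -> (p < r)%N ->
    B r s (tmerge (inord p) (inord p.+1) x) y
    = @tmerge _ A (r + s) (inord p) (inord p.+1) (B r.+1 s x y);
  ida_merge_right r s (x : tpow A r) (y : tpow A s.+1) p :
    (0 < r)%N -> (0 < s)%N -> (p < s)%N ->
    B r s x (tmerge (inord p) (inord p.+1) y)
    = tmerge (inord (r + p)) (inord (r + p).+1)
        (castT (addnS r s) (B r s.+1 x y));
  ida_blocks_right r s (x : tpow A r) (y : tpow A s) l (tau : 'S_l) (d : l.-tuple nat) :
    (0 < r)%N -> (0 < s)%N -> (forall i, (0 < tnth d i)%N) ->
    (\sum_(i < l) tnth d i)%N = s ->
    B r s x (tact (bperm tau d s) y)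
    = tact (bperm (pcat (1%g : 'S_1) tau) [tuple of r :: d] (r + s)) (B r s x y);
  ida_blocks_left r s (x : tpow A r) (y : tpow A s) l (tau : 'S_l) (d : l.-tuple nat) :
    (0 < r)%N -> (0 < s)%N -> (forall i, (0 < tnth d i)%N) ->
    (\sum_(i < l) tnth d i)%N = s ->
    B s r (tact (bperm tau d s) y) x = tact (bperm tau d (s + r)) (B s r y x)
}.

Definition restriction (br : obracket) (B : tbracket) : Prop :=
  forall r s (x : tpow A r) (y : tpow A s), (0 < r)%N -> (0 < s)%N ->
    br r s (hat x) (hat y) = hat (B r s x y).

End Structures.

(* Main.v *)
Require Import Defs.
From mathcomp Require Import all_boot all_order all_algebra all_fingroup.
From mathcomp Require Import sesquilinear boolp zify.

(** The bracket of O(A) is governed by the single operator d = [[1, -]], where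
    1 is the unit of O(A). Put the unit in the first slot of the Leibniz
    identity: it reads 2 z d(y) = [[z, y]] + d(z y), since the block
    permutation in it moves an empty block ([br_Leibniz0]). So d determines the
    bracket, and antisymmetry, compared with the same formula for (y, z), says
    that 2 d(z y) = 2 (z d(y) + d(z) y). As 2 is invertible, d is a derivation
    and [[x, y]] = x d(y) - d(x) y ([br_dbracket]). The remaining axioms make d
    commute with the bimodule structure and with pi, and vanish on the letter 1
    ([bder_derivation]). Conversely, all axioms of a double transposed Poisson
    bracket hold for x d(y) - d(x) y when d is such a derivation
    ([dbracket_dtp]).

    The derivation d is in turn determined by delta, its restriction to A,
    because O(A) is generated by A under products, permutations and pi
    ([der_ext]). If delta takes its values in A, it is a derivation D of A:
    the product of A is pi applied to a (x) b twisted by the transposition,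
    which turns the Leibniz rule for a (x) b into the one for a b
    ([delta_induces]). Any derivation D of A extends to O(A) = A^n (x) S(A_nat)
    (x) k[S_n] by the Leibniz rule ([oder_derivation]), and by uniqueness the
    extension is d. On tensors it is the extension of D to tensor powers, so
    the bracket restricts there to x D(y) - D(x) y. This gives the equivalences
    and the explicit formula. Antisymmetry, Jacobi and left Leibniz
    identities of the restriction are inherited from O(A), and the other
    identities of an adapted structure say that D is compatible with products,
    insertions of 1, multiplications of neighbours and block permutations
    ([tdbracket_id_adapted]).

    For an adapted structure B the same argument runs with the letter 1 in
    place of the unit: B(1, y) = 1 (x) E(y), the Leibniz identity yields
    2 z E(y) = B(z, y) + E(z y), and E is a derivation of the tensor algebra,
    hence comes from a derivation D of A ([BE], [bD_mul]). The bracket built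
    from D restricts to B, and it is the only one: a bracket that
    restricts to tensors is determined by its derivation of A, and B recovers
    the latter, as B(1, a) = 1 (x) D(a). *)

Set Implicit Arguments.
Unset Strict Implicit.
Unset Printing Implicit Defensive.

Import GRing.Theory.
Local Open Scope ring_scope.

(** * Linear maps *)
(* Unification meets several coercion paths to the module structures of tpow,
   Anat, symalg and OA. With their operations sealed it compares the paths by
   their heads, instead of unfolding both sides down to quotients of free
   modules. *)
Opaque Defs.HB_unnamed_mixin_87 Defs.HB_unnamed_mixin_88
  Defs.HB_unnamed_mixin_89 Defs.HB_unnamed_mixin_90 Defs.HB_unnamed_mixin_91
  Defs.HB_unnamed_mixin_92 Defs.HB_unnamed_mixin_93 Defs.HB_unnamed_mixin_94
  Defs.HB_unnamed_mixin_95 Defs.HB_unnamed_mixin_96 Defs.HB_unnamed_mixin_118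
  Defs.HB_unnamed_mixin_119 Defs.HB_unnamed_mixin_120 Defs.HB_unnamed_mixin_121
  Defs.HB_unnamed_mixin_122 Defs.HB_unnamed_mixin_123 Defs.HB_unnamed_mixin_124
  Defs.HB_unnamed_mixin_125 Defs.HB_unnamed_mixin_126 Defs.HB_unnamed_mixin_127
  Defs.HB_unnamed_mixin_162 Defs.HB_unnamed_mixin_163 Defs.HB_unnamed_mixin_164
  Defs.HB_unnamed_mixin_165 Defs.HB_unnamed_mixin_166 Defs.HB_unnamed_mixin_167
  Defs.HB_unnamed_mixin_168 Defs.HB_unnamed_mixin_169 Defs.HB_unnamed_mixin_170
  Defs.HB_unnamed_mixin_171 Defs.HB_unnamed_mixin_194 Defs.HB_unnamed_mixin_195
  Defs.HB_unnamed_mixin_196 Defs.HB_unnamed_mixin_197 Defs.HB_unnamed_mixin_198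
  Defs.HB_unnamed_mixin_199 Defs.HB_unnamed_mixin_200 Defs.HB_unnamed_mixin_201
  Defs.HB_unnamed_mixin_202 Defs.HB_unnamed_mixin_203.

Section Linear.
Variables (k : fieldType) (U V W : lmodType k).

Section Rules.
Variable f : V -> W.
Hypothesis fL : linear f.

Lemma lin0 : f 0 = 0.
Proof. by have := fL (-1) 0 0; rewrite !scaleN1r !addNr. Qed.
Lemma linD x y : f (x + y) = f x + f y.
Proof. by have := fL 1 x y; rewrite !scale1r. Qed.
Lemma linZ c x : f (c *: x) = c *: f x.
Proof. by have := fL c x 0; rewrite lin0 !addr0. Qed.
Lemma linN x : f (- x) = - f x.
Proof. by rewrite -scaleN1r linZ scaleN1r. Qed.
Lemma linB x y : f (x - y) = f x - f y.
Proof. by rewrite linD linN. Qed.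
Lemma lin_sum (I : Type) (r : seq I) (P : pred I) (F : I -> V) :
  f (\sum_(i <- r | P i) F i) = \sum_(i <- r | P i) f (F i).
Proof. by apply: (big_morph f linD lin0). Qed.
End Rules.

Lemma lin_id : linear (fun x : V => x). Proof. by []. Qed.
Lemma lin_comp (f : V -> W) (g : U -> V) :
  linear f -> linear g -> linear (fun x => f (g x)).
Proof. by move=> fL gL c x y; rewrite gL fL. Qed.
Lemma lin_add (f g : V -> W) :
  linear f -> linear g -> linear (fun x => f x + g x).
Proof. by move=> fL gL c x y; rewrite fL gL scalerDr addrACA. Qed.
Lemma lin_opp (f : V -> W) : linear f -> linear (fun x => - f x).
Proof. by move=> fL c x y; rewrite fL opprD scalerN. Qed.
End Linear.

Section Shapes.
Variables (k : fieldType) (A : algType k).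

Section Compositions.
Variable V : lmodType k.

Lemma lin_castT n m (e : n = m) (f : V -> tpow A n) :
  linear f -> linear (fun x => castT e (f x)).
Proof. by case: m / e. Qed.
Lemma lin_castO n m (e : n = m) (f : V -> OA A n) :
  linear f -> linear (fun x => castO e (f x)).
Proof. by case: m / e. Qed.
Lemma lin_tact n (s : 'S_n) (f : V -> tpow A n) :
  linear f -> linear (fun x => tact s (f x)).
Proof. exact: (lin_comp (tact_linear s)). Qed.
Lemma lin_oact n (s t : 'S_n) (f : V -> OA A n) :
  linear f -> linear (fun x => oact s t (f x)).
Proof. exact: (lin_comp (oact_linear s t)). Qed.
Lemma lin_Ad n (s : 'S_n) (f : V -> OA A n) :
  linear f -> linear (fun x => Ad s (f x)).
Proof. exact: lin_oact. Qed.
Lemma lin_opi n (f : V -> OA A n.+1) :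
  linear f -> linear (fun x => opi (f x)).
Proof. exact: (lin_comp (@opi_linear _ _ n)). Qed.
Lemma lin_tins n (r : 'I_n.+1) b (f : V -> tpow A n) :
  linear f -> linear (fun x => tins r b (f x)).
Proof. exact: (lin_comp (tins_linear r b)). Qed.
Lemma lin_tmerge n (u v : 'I_n.+1) (f : V -> tpow A n.+1) :
  u != v -> linear f -> linear (fun x => tmerge u v (f x)).
Proof. by move=> uv; apply: lin_comp; apply: tmerge_linear. Qed.
Lemma lin_tder D n (f : V -> tpow A n) :
  linear D -> linear f -> linear (fun x => tder D (f x)).
Proof. by move=> DL; apply: lin_comp; apply: tder_linear. Qed.
Lemma lin_tcatl n m (y : tpow A m) (f : V -> tpow A n) :
  linear f -> linear (fun x => tcat (f x) y).
Proof. exact: (lin_comp ((tcat_bilinear A n m).1 y)). Qed.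
Lemma lin_tcatr n m (y : tpow A m) (f : V -> tpow A n) :
  linear f -> linear (fun x => tcat y (f x)).
Proof. exact: (lin_comp ((tcat_bilinear A m n).2 y)). Qed.
Lemma lin_omull n m (y : OA A m) (f : V -> OA A n) :
  linear f -> linear (fun x => omul (f x) y).
Proof. exact: (lin_comp ((omul_bilinear A n m).1 y)). Qed.
Lemma lin_omulr n m (y : OA A m) (f : V -> OA A n) :
  linear f -> linear (fun x => omul y (f x)).
Proof. exact: (lin_comp ((omul_bilinear A m n).2 y)). Qed.
Lemma lin_opurel n h (u : 'S_n) (f : V -> tpow A n) :
  linear f -> linear (fun x => opure (f x) h u).
Proof. exact: (lin_comp (@opure_linearl _ _ n h u)). Qed.
Lemma lin_opurer n (a : tpow A n) (u : 'S_n) (f : V -> symalg (Anat A)) :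
  linear f -> linear (fun x => opure a (f x) u).
Proof. exact: (lin_comp (@opure_linearr _ _ n a u)). Qed.
Lemma lin_hat n (f : V -> tpow A n) :
  linear f -> linear (fun x => hat (f x)).
Proof. exact: lin_opurel. Qed.
End Compositions.

(** Identities between multilinear operations of O(A) reduce to pure tensors
    of elements of A, where they become identities between functions of a
    position. *)
Lemma OA_eqp n (W : lmodType k) (f g : OA A n -> W) : linear f -> linear g ->
  (forall a h u, f (opure (ptens a) h u) = g (opure (ptens a) h u)) ->
  forall x, f x = g x.
Proof.
move=> fL gL e; apply: OA_eq => // x h u; move: x.
by apply: ptens_eq => [||a]; [exact: lin_comp (opure_linearl h u)..|exact: e].
Qed.
End Shapes.

(* Linearity of a composite, by the head symbol of its body. Eta-reduced heads
   need cases of their own. *)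
Ltac lin := repeat match goal with
  | |- GRing.linear_for _ (fun x => x) => exact: lin_id
  | |- GRing.linear_for _ (fun x => omul x _) => apply: lin_omull; exact: lin_id
  | |- GRing.linear_for _ (fun x => omul _ x) => apply: lin_omulr; exact: lin_id
  | |- GRing.linear_for _ (fun x => omul _ _) =>
      first [apply: lin_omulr | apply: lin_omull]
  | |- GRing.linear_for _ (fun x => tcat _ _) =>
      first [apply: lin_tcatr | apply: lin_tcatl]
  | |- GRing.linear_for _ (fun x => castO _ _) => apply: lin_castO
  | |- GRing.linear_for _ (fun x => castT _ _) => apply: lin_castT
  | |- GRing.linear_for _ (fun x => Ad _ _) => apply: lin_Ad
  | |- GRing.linear_for _ (fun x => oact _ _ _) => apply: lin_oact
  | |- GRing.linear_for _ (fun x => tact _ _) => apply: lin_tact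
  | |- GRing.linear_for _ (fun x => opi _) => apply: lin_opi
  | |- GRing.linear_for _ (fun x => tins _ _ _) => apply: lin_tins
  | |- GRing.linear_for _ (fun x => tmerge _ _ _) => apply: lin_tmerge
  | |- GRing.linear_for _ (fun x => tder _ _) => apply: lin_tder
  | |- GRing.linear_for _ (fun x => hat _) => apply: lin_hat
  | |- GRing.linear_for _ (fun x => opure _ _ _) =>
      first [apply: lin_opurel | apply: lin_opurer]
  | |- GRing.linear_for _ (fun x => _ + _) => apply: lin_add
  | |- GRing.linear_for _ (fun x => - _) => apply: lin_opp
  | |- GRing.linear_for _ (omul _) => apply: lin_omulr; exact: lin_id
  | |- GRing.linear_for _ (tcat _) => apply: lin_tcatr; exact: lin_id
  | |- GRing.linear_for _ (castO _) => apply: lin_castO; exact: lin_id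
  | |- GRing.linear_for _ (castT _) => apply: lin_castT; exact: lin_id
  | |- GRing.linear_for _ (@hat _ _ _) => apply: lin_hat; exact: lin_id
  | |- GRing.linear_for _ (@opi _ _ _) => apply: lin_opi; exact: lin_id
  | |- GRing.linear_for _ (oact _ _) => apply: lin_oact; exact: lin_id
  | |- GRing.linear_for _ (Ad _) => apply: lin_Ad; exact: lin_id
  | |- GRing.linear_for _ (tins _ _) => apply: lin_tins; exact: lin_id
  | |- GRing.linear_for _ (@tder _ _ _ _) => apply: lin_tder; [|exact: lin_id]
  | |- GRing.linear_for _ (tmerge _ _) =>
      first [assumption | apply: lin_tmerge; [|exact: lin_id]]
  | |- GRing.linear_for _ (tact _) => apply: lin_tact; exact: lin_id
  | |- _ => assumption
  end.

Section Transport.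
Variables (k : fieldType) (A : algType k).

Lemma castTE n m (e : n = m) (a : {ffun 'I_n -> A}) :
  castT e (ptens a) = ptens [ffun i => a (cast_ord (esym e) i)].
Proof.
case: m / e; rewrite /castT /=; congr ptens; apply/ffunP => i.
by rewrite ffunE cast_ord_id.
Qed.

Lemma castT_id n (e : n = n) (x : tpow A n) : castT e x = x.
Proof. by rewrite (eq_axiomK e). Qed.

Lemma castO_id n (e : n = n) (x : OA A n) : castO e x = x.
Proof. by rewrite (eq_axiomK e). Qed.

Lemma castT_trans n m p (e : n = m) (e' : m = p) (e'' : n = p) (x : tpow A n) :
  castT e' (castT e x) = castT e'' x.
Proof. by case: p / e' e''; case: m / e => e''; rewrite !castT_id. Qed.

(** Under Ad s the letter at position i moves to s i and the permutation is
    conjugated, so both can be compared position by position. All identities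
    with block permutations below come from this one. *)
Lemma castO_Ad n m (e : n = m) (s u : 'S_n) (v : 'S_m) (a : {ffun 'I_n -> A})
    (b : {ffun 'I_m -> A}) h :
  (forall i, b (cast_ord e (s i)) = a i) ->
  (forall i, v (cast_ord e (s i)) = cast_ord e (s (u i))) ->
  castO e (Ad s (opure (ptens a) h u)) = opure (ptens b) h v :> OA A m.
Proof.
case: m / e b v => b v hb hv; rewrite /castO /= /Ad oactE tactE.
congr opure; first congr ptens.
  by apply/ffunP => i; rewrite ffunE -hb cast_ord_id permKV.
apply/permP => i; rewrite !permM; have := hv (s^-1%g i).
by rewrite !cast_ord_id permKV => ->.
Qed.

Lemma castO_pure n m (e : n = m) (u : 'S_n) (v : 'S_m) (a : {ffun 'I_n -> A})
    (b : {ffun 'I_m -> A}) h :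
  (forall i, b (cast_ord e i) = a i) ->
  (forall i, v (cast_ord e i) = cast_ord e (u i)) ->
  castO e (opure (ptens a) h u) = opure (ptens b) h v :> OA A m.
Proof.
case: m / e b v => b v hb hv; rewrite /castO /=.
congr opure; first congr ptens.
  by apply/ffunP => i; rewrite -hb cast_ord_id.
by apply/permP => i; have := hv i; rewrite !cast_ord_id => ->.
Qed.
End Transport.

(** * Positions under block permutations *)
Section Positions.
Local Open Scope nat_scope.

Lemma pcatl n m (u : 'S_n) (v : 'S_m) i : pcat u v (lshift m i) = lshift m (u i).
Proof. by rewrite permE /pcat_fun (unsplitK (inl i)). Qed.
Lemma pcatr n m (u : 'S_n) (v : 'S_m) i : pcat u v (rshift n i) = rshift n (v i).
Proof. by rewrite permE /pcat_fun (unsplitK (inr i)). Qed.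

Lemma ord_addP n m (P : 'I_(n + m) -> Prop) :
  (forall i, P (lshift m i)) -> (forall i, P (rshift n i)) -> forall i, P i.
Proof. by move=> Pl Pr i; rewrite -(splitK i); case: (split i). Qed.

Lemma bperm_block l (tau : 'S_l) (d : l.-tuple nat) i o q N (p : 'I_N) :
  \sum_(j < l) tnth d j <= N -> o < tnth d i -> p = old_start d i + o :> nat ->
  new_start tau d i + o = q -> bperm tau d N p = q :> nat.
Proof. by move=> dN od e <-; rewrite bpermE // e block_funE. Qed.

(* Evaluates a sum over an explicit number of blocks. *)
Ltac starts := rewrite big_mkcond !big_ord_recl big_ord0 ?(tnth_nth 0) /= ?addn0 ?add0n ?addnA.

Section TwoBlocks.
Variables (n m N : nat) (p : 'I_N) (o : nat).
Hypothesis le : n + m <= N.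

Let le' : \sum_(j < 2) tnth [tuple n; m] j <= N.
Proof. by rewrite !big_ord_recl big_ord0 !(tnth_nth 0) /= addn0. Qed.

Lemma s12_fst : o < n -> p = o :> nat -> bperm s12 [tuple n; m] N p = m + o :> nat.
Proof.
move=> lo e; apply: (@bperm_block _ _ _ ord0 o) => //.
  by rewrite e /old_start; starts.
by rewrite /new_start /s12; starts; rewrite !permE /= ?addn0.
Qed.

Lemma s12_snd : o < m -> p = n + o :> nat -> bperm s12 [tuple n; m] N p = o :> nat.
Proof.
move=> lo e; apply: (@bperm_block _ _ _ (lift ord0 ord0) o) => //.
  by rewrite e /old_start; starts.
by rewrite /new_start /s12; starts; rewrite !permE /=.
Qed.

Lemma s12_out : n + m <= p -> bperm s12 [tuple n; m] N p = p.
Proof.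
move=> np; apply/val_inj; rewrite /= bpermE // block_fun_out //.
by rewrite !big_ord_recl big_ord0 !(tnth_nth 0) /= addn0.
Qed.
End TwoBlocks.

Section ThreeBlocks.
Variables (n m q N : nat) (p : 'I_N) (o : nat).
Hypothesis le : n + m + q <= N.

Let le' : \sum_(j < 3) tnth [tuple n; m; q] j <= N.
Proof. by rewrite !big_ord_recl big_ord0 !(tnth_nth 0) /= addn0 addnA. Qed.

Lemma bperm3_fst (tau : 'S_3) r : o < n -> p = o :> nat ->
  new_start tau [tuple n; m; q] ord0 + o = r ->
  bperm tau [tuple n; m; q] N p = r :> nat.
Proof.
move=> lo e; apply: bperm_block => //.
by rewrite e /old_start; starts.
Qed.

Lemma bperm3_snd (tau : 'S_3) r : o < m -> p = n + o :> nat ->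
  new_start tau [tuple n; m; q] (lift ord0 ord0) + o = r ->
  bperm tau [tuple n; m; q] N p = r :> nat.
Proof.
move=> lo e; apply: bperm_block => //.
by rewrite e /old_start; starts.
Qed.

Lemma bperm3_thd (tau : 'S_3) r : o < q -> p = n + m + o :> nat ->
  new_start tau [tuple n; m; q] (lift ord0 (lift ord0 ord0)) + o = r ->
  bperm tau [tuple n; m; q] N p = r :> nat.
Proof.
move=> lo e; apply: bperm_block => //.
by rewrite e /old_start; starts.
Qed.
End ThreeBlocks.

Ltac newstart := rewrite /new_start; starts; rewrite /s12 /s123 /s132 /s23 !permE
  /= -?val_eqE /= ?inordK //= ?addn0 ?add0n ?addnA.

(* The landing place of each block, written with the injections lshift and
   rshift on which concatenations compute. *)
Section Moves.
Variables n m p : nat.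

Lemma swap_l (i : 'I_n) :
  cast_ord (addnC n m) (bperm s12 [tuple n; m] (n + m) (lshift m i)) = rshift m i.
Proof. by apply/val_inj; rewrite /= (s12_fst _ (ltn_ord i)). Qed.
Lemma swap_r (i : 'I_m) :
  cast_ord (addnC n m) (bperm s12 [tuple n; m] (n + m) (rshift n i)) = lshift n i.
Proof. by apply/val_inj; rewrite /= (s12_snd _ (ltn_ord i)). Qed.

Let le : n + p <= n + (p + m). Proof. by rewrite leq_add2l leq_addr. Qed.

Lemma swap12_1 (i : 'I_n) :
  cast_ord (addnCA n p m) (bperm s12 [tuple n; p] (n + (p + m)) (lshift (p + m) i))
  = rshift p (lshift m i).
Proof. by apply/val_inj; rewrite /= (s12_fst _ (ltn_ord i)). Qed.
Lemma swap12_2 (i : 'I_p) :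
  cast_ord (addnCA n p m)
    (bperm s12 [tuple n; p] (n + (p + m)) (rshift n (lshift m i)))
  = lshift (n + m) i.
Proof. by apply/val_inj; rewrite /= (s12_snd _ (ltn_ord i)). Qed.
Lemma swap12_3 (i : 'I_m) :
  cast_ord (addnCA n p m)
    (bperm s12 [tuple n; p] (n + (p + m)) (rshift n (rshift p i)))
  = rshift p (rshift n i).
Proof.
by apply/val_inj; rewrite /= s12_out //= ?addnA ?leq_addr // [p + n]addnC.
Qed.

Let le3 : n + m + p <= n + (m + p). Proof. by rewrite addnA. Qed.

Lemma rot123_1 (i : 'I_n) :
  cast_ord (addn_rot n m p) (bperm s123 [tuple n; m; p] (n + (m + p)) (lshift _ i))
  = rshift p (lshift m i).
Proof. by apply/val_inj; rewrite /= (bperm3_fst _ (ltn_ord i) _ erefl) //; newstart; lia. Qed.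
Lemma rot123_2 (i : 'I_m) :
  cast_ord (addn_rot n m p)
    (bperm s123 [tuple n; m; p] (n + (m + p)) (rshift n (lshift p i)))
  = rshift p (rshift n i).
Proof. by apply/val_inj; rewrite /= (bperm3_snd _ (ltn_ord i) _ erefl) //; newstart; lia. Qed.
Lemma rot123_3 (i : 'I_p) :
  cast_ord (addn_rot n m p)
    (bperm s123 [tuple n; m; p] (n + (m + p)) (rshift n (rshift m i)))
  = lshift (n + m) i.
Proof.
by apply/val_inj; rewrite /= (bperm3_thd _ (ltn_ord i) _ erefl) //= ?addnA //; newstart; lia.
Qed.

Lemma rot132_1 (i : 'I_n) :
  cast_ord (addn_rot2 n m p) (bperm s132 [tuple n; m; p] (n + (m + p)) (lshift _ i))
  = rshift m (rshift p i).
Proof. by apply/val_inj; rewrite /= (bperm3_fst _ (ltn_ord i) _ erefl) //; newstart; lia. Qed.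
Lemma rot132_2 (i : 'I_m) :
  cast_ord (addn_rot2 n m p)
    (bperm s132 [tuple n; m; p] (n + (m + p)) (rshift n (lshift p i)))
  = lshift (p + n) i.
Proof. by apply/val_inj; rewrite /= (bperm3_snd _ (ltn_ord i) _ erefl) //; newstart; lia. Qed.
Lemma rot132_3 (i : 'I_p) :
  cast_ord (addn_rot2 n m p)
    (bperm s132 [tuple n; m; p] (n + (m + p)) (rshift n (rshift m i)))
  = rshift m (lshift n i).
Proof.
by apply/val_inj; rewrite /= (bperm3_thd _ (ltn_ord i) _ erefl) //= ?addnA //; newstart; lia.
Qed.

Lemma back_1 (i : 'I_n) :
  cast_ord (addn_back n m p)
    (bperm s132 [tuple n; m; p] (n + m + p) (lshift p (lshift m i)))
  = rshift (m + p) i.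
Proof. by apply/val_inj; rewrite /= (bperm3_fst _ (ltn_ord i) _ erefl) //; newstart; lia. Qed.
Lemma back_2 (i : 'I_m) :
  cast_ord (addn_back n m p)
    (bperm s132 [tuple n; m; p] (n + m + p) (lshift p (rshift n i)))
  = lshift n (lshift p i).
Proof. by apply/val_inj; rewrite /= (bperm3_snd _ (ltn_ord i) _ erefl) //; newstart; lia. Qed.
Lemma back_3 (i : 'I_p) :
  cast_ord (addn_back n m p)
    (bperm s132 [tuple n; m; p] (n + m + p) (rshift (n + m) i))
  = lshift n (rshift m i).
Proof. by apply/val_inj; rewrite /= (bperm3_thd _ (ltn_ord i) _ erefl) //; newstart; lia. Qed.

Lemma swap23_1 (i : 'I_n) :
  cast_ord (addn_swap n m p) (bperm s23 [tuple n; m; p] (n + (m + p)) (lshift _ i))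
  = lshift m (lshift p i).
Proof. by apply/val_inj; rewrite /= (bperm3_fst _ (ltn_ord i) _ erefl) //; newstart; lia. Qed.
Lemma swap23_2 (i : 'I_m) :
  cast_ord (addn_swap n m p)
    (bperm s23 [tuple n; m; p] (n + (m + p)) (rshift n (lshift p i)))
  = rshift (n + p) i.
Proof. by apply/val_inj; rewrite /= (bperm3_snd _ (ltn_ord i) _ erefl) //; newstart; lia. Qed.
Lemma swap23_3 (i : 'I_p) :
  cast_ord (addn_swap n m p)
    (bperm s23 [tuple n; m; p] (n + (m + p)) (rshift n (rshift m i)))
  = lshift m (rshift n i).
Proof.
by apply/val_inj; rewrite /= (bperm3_thd _ (ltn_ord i) _ erefl) //= ?addnA //; newstart; lia.
Qed.
End Moves.
End Positions.

(** * Products in O(A) *)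
Section Products.
Variables (k : fieldType) (A : algType k).

Lemma fcatl n m (a : {ffun 'I_n -> A}) (b : {ffun 'I_m -> A}) i :
  fcat a b (lshift m i) = a i.
Proof. by rewrite ffunE (unsplitK (inl i)). Qed.
Lemma fcatr n m (a : {ffun 'I_n -> A}) (b : {ffun 'I_m -> A}) i :
  fcat a b (rshift n i) = b i.
Proof. by rewrite ffunE (unsplitK (inr i)). Qed.

Ltac blockwise moves :=
  apply: ord_addP; try apply: ord_addP; move=> ?;
  rewrite ?(pcatl, pcatr) ?moves ?(pcatl, pcatr, fcatl, fcatr) //.

(** Conjugation by a block permutation permutes the factors of a product; the
    coefficients in S(A_nat) commute. The lemmas below are the cases that occur
    in the axioms. *)
Lemma omul_swap n m (x : OA A n) (y : OA A m) :
  castO (addnC n m) (Ad (bperm s12 [tuple n; m] (n + m)) (omul x y)) = omul y x.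
Proof.
move: x; apply: OA_eqp; [lin|lin|move=> a f u].
move: y; apply: OA_eqp; [lin|lin|move=> b g v].
rewrite !omulE !tcatE (mulrC g f).
by apply: castO_Ad; blockwise (@swap_l n m, @swap_r n m).
Qed.

Lemma omulA n m p (x : OA A n) (y : OA A m) (z : OA A p) :
  castO (esym (addnA n m p)) (omul (omul x y) z) = omul x (omul y z).
Proof.
move: x; apply: OA_eqp; [lin|lin|move=> a f u].
move: y; apply: OA_eqp; [lin|lin|move=> b g v].
move: z; apply: OA_eqp; [lin|lin|move=> c h w].
rewrite !omulE !tcatE mulrA.
have e1 i : cast_ord (esym (addnA n m p)) (lshift p (lshift m i)) = lshift (m + p) i.
  exact: val_inj.
have e2 i : cast_ord (esym (addnA n m p)) (lshift p (rshift n i))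
          = rshift n (lshift p i) by exact: val_inj.
have e3 i : cast_ord (esym (addnA n m p)) (rshift (n + m) i)
          = rshift n (rshift m i) by apply: val_inj; rewrite /= addnA.
by apply: castO_pure; blockwise (e1, e2, e3).
Qed.

Lemma omul_swap12 n p m (x : OA A n) (y : OA A p) (z : OA A m) :
  castO (addnCA n p m)
    (Ad (bperm s12 [tuple n; p] (n + (p + m))) (omul x (omul y z)))
  = omul y (omul x z).
Proof.
move: x; apply: OA_eqp; [lin|lin|move=> a f u].
move: y; apply: OA_eqp; [lin|lin|move=> b g v].
move: z; apply: OA_eqp; [lin|lin|move=> c h w].
rewrite !omulE !tcatE [g * (f * h)]mulrCA.
by apply: castO_Ad; blockwise (@swap12_1 n m p, @swap12_2 n m p, @swap12_3 n m p).
Qed.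

Lemma omul_rot123 n m p (x : OA A n) (y : OA A m) (z : OA A p) :
  castO (addn_rot n m p)
    (Ad (bperm s123 [tuple n; m; p] (n + (m + p))) (omul x (omul y z)))
  = omul z (omul x y).
Proof.
move: x; apply: OA_eqp; [lin|lin|move=> a f u].
move: y; apply: OA_eqp; [lin|lin|move=> b g v].
move: z; apply: OA_eqp; [lin|lin|move=> c h w].
rewrite !omulE !tcatE [h * (f * g)]mulrC -[f * g * h]mulrA.
by apply: castO_Ad; blockwise (@rot123_1 n m p, @rot123_2 n m p, @rot123_3 n m p).
Qed.

Lemma omul_rot132 n m p (x : OA A n) (y : OA A m) (z : OA A p) :
  castO (addn_rot2 n m p)
    (Ad (bperm s132 [tuple n; m; p] (n + (m + p))) (omul x (omul y z)))
  = omul y (omul z x).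
Proof.
move: x; apply: OA_eqp; [lin|lin|move=> a f u].
move: y; apply: OA_eqp; [lin|lin|move=> b g v].
move: z; apply: OA_eqp; [lin|lin|move=> c h w].
rewrite !omulE !tcatE [f * (g * h)]mulrC -[g * h * f]mulrA.
by apply: castO_Ad; blockwise (@rot132_1 n m p, @rot132_2 n m p, @rot132_3 n m p).
Qed.

Lemma omul_back n m p (x : OA A n) (y : OA A m) (z : OA A p) :
  castO (addn_back n m p)
    (Ad (bperm s132 [tuple n; m; p] (n + m + p)) (omul (omul x y) z))
  = omul (omul y z) x.
Proof.
move: x; apply: OA_eqp; [lin|lin|move=> a f u].
move: y; apply: OA_eqp; [lin|lin|move=> b g v].
move: z; apply: OA_eqp; [lin|lin|move=> c h w].
rewrite !omulE !tcatE [g * h * f]mulrC [f * (g * h)]mulrA.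
by apply: castO_Ad; blockwise (@back_1 n m p, @back_2 n m p, @back_3 n m p).
Qed.

Lemma omul_swap23 n m p (x : OA A n) (y : OA A m) (z : OA A p) :
  castO (addn_swap n m p)
    (Ad (bperm s23 [tuple n; m; p] (n + (m + p))) (omul x (omul y z)))
  = omul (omul x z) y.
Proof.
move: x; apply: OA_eqp; [lin|lin|move=> a f u].
move: y; apply: OA_eqp; [lin|lin|move=> b g v].
move: z; apply: OA_eqp; [lin|lin|move=> c h w].
rewrite !omulE !tcatE -[f * h * g]mulrA [h * g]mulrC.
by apply: castO_Ad; blockwise (@swap23_1 n m p, @swap23_2 n m p, @swap23_3 n m p).
Qed.

Lemma pcat0 n (u : 'S_0) (v : 'S_n) : pcat u v = v.
Proof.
apply/permP => i; have e (j : 'I_n) : rshift 0 j = j by exact: val_inj.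
by rewrite -[i in LHS]e pcatr e.
Qed.

Lemma pcat1 n m : pcat (1 : 'S_n)%g (1 : 'S_m)%g = 1%g.
Proof. by apply/permP; apply: ord_addP => i; rewrite ?(pcatl, pcatr) !perm1. Qed.

Lemma tcat0 n (x : tpow A n) : tcat (tone0 A) x = x.
Proof.
move: x; apply: ptens_eq => [||a]; [lin|lin|rewrite /tone0 tcatE].
congr ptens; apply/ffunP => i; have e (j : 'I_n) : rshift 0 j = j by exact: val_inj.
by rewrite -[i in LHS]e fcatr.
Qed.

Lemma omul1l n (x : OA A n) : omul (oone A) x = x.
Proof.
move: x; apply: OA_eqp; [lin|lin|move=> a f u].
by rewrite /oone omulE pcat0 tcat0 mul1r.
Qed.

Lemma omul1r n (x : OA A n) : castO (addn0 n) (omul x (oone A)) = x.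
Proof.
move: x; apply: OA_eqp; [lin|lin|move=> a f u].
rewrite /oone omulE tcatE mulr1.
have e i : cast_ord (addn0 n) (lshift 0 i) = i by exact: val_inj.
by apply: castO_pure; apply: ord_addP => [i|[]//]; rewrite ?pcatl ?e ?fcatl.
Qed.

Lemma hat_cat n m (x : tpow A n) (y : tpow A m) :
  hat (tcat x y) = omul (hat x) (hat y).
Proof. by rewrite /hat omulE mulr1 pcat1. Qed.

Lemma castO_hat n m (e : n = m) (x : tpow A n) : castO e (hat x) = hat (castT e x).
Proof. by case: m / e. Qed.

Lemma Ad_hat n (s : 'S_n) (x : tpow A n) : Ad s (hat x) = hat (tact s x).
Proof. by rewrite /Ad /hat oactE mulg1 mulVg. Qed.

(** The augmentation of S(A_nat). *)
Definition aug (f : symalg (Anat A)) : k^o :=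
  plift (fun s : seq (Anat A) => (nilp s)%:R : k^o) f.

Let aug_perm (s t : seq (Anat A)) : perm_eq s t -> (nilp s)%:R = (nilp t)%:R :> k^o.
Proof. by move/perm_size => st; rewrite /nilp st. Qed.
Let aug_lin (s : seq (Anat A)) : linear (fun u : Anat A => (nilp (u :: s))%:R : k^o).
Proof. by move=> c u v; rewrite /= scaler0 addr0. Qed.

Lemma aug_linear : linear aug.
Proof. exact: sym_lift_linear. Qed.
Lemma aug1 : aug 1 = 1.
Proof. exact: (sym_liftE aug_perm aug_lin [::]). Qed.

(** A linear left inverse of hat. *)
Definition oaug n : OA A n -> tpow A n := OA_lift (fun x f _ => (aug f : k) *: x).

Let oaug_multi n :
  (forall f (u : 'S_n), linear (fun x : tpow A n => (aug f : k) *: x)) *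
  (forall (x : tpow A n) (u : 'S_n), linear (fun f => (aug f : k) *: x)).
Proof.
split=> [f u c x y|x u c f g].
  by rewrite scalerDr !scalerA mulrC.
by rewrite aug_linear scalerDl scalerA.
Qed.

Lemma oaugE n x f u : @oaug n (opure x f u) = (aug f : k) *: x.
Proof. by have [m1 m2] := oaug_multi n; apply: OA_liftE. Qed.
Lemma oaug_linear n : linear (@oaug n).
Proof. by have [m1 m2] := oaug_multi n; apply: OA_lift_linear. Qed.
Lemma hatK n : cancel (@hat k A n) (@oaug n).
Proof. by move=> x; rewrite /hat oaugE aug1 scale1r. Qed.
Lemma hat_inj n : injective (@hat k A n).
Proof. exact: can_inj (@hatK n). Qed.

Definition unt1 : tpow A 1 -> A := ptens_lift (fun a => a ord0).

Let unt1_multi : multilinear (fun a : {ffun 'I_1 -> A} => a ord0).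
Proof. by move=> a i c x y; rewrite !ffunE !ord1. Qed.

Lemma t1K : cancel (@t1 k A) unt1.
Proof. by move=> a; rewrite /unt1 ptens_liftE // ffunE. Qed.
Lemma unt1_linear : linear unt1.
Proof. exact: ptens_lift_linear. Qed.
Lemma unt1K : cancel unt1 (@t1 k A).
Proof.
apply: ptens_eq => [||a]; [exact: (lin_comp (@t1_linear k A) unt1_linear)|exact: lin_id|].
rewrite /unt1 ptens_liftE // /t1; congr ptens; apply/ffunP => i.
by rewrite ffunE !ord1.
Qed.
End Products.

(** * The operation pi and products *)
Section Calculus.
Variables (k : fieldType) (A : algType k).
Implicit Types (n m p : nat).

Lemma omulBr n m (x : OA A n) (y y' : OA A m) :
  omul x (y - y') = omul x y - omul x y'.
Proof. exact: (linB ((omul_bilinear A n m).2 x)). Qed.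
Lemma omulDl n m (x x' : OA A n) (y : OA A m) :
  omul (x + x') y = omul x y + omul x' y.
Proof. exact: (linD ((omul_bilinear A n m).1 y)). Qed.
Lemma omulDr n m (x : OA A n) (y y' : OA A m) :
  omul x (y + y') = omul x y + omul x y'.
Proof. exact: (linD ((omul_bilinear A n m).2 x)). Qed.
Lemma omul0l n m (y : OA A m) : omul (0 : OA A n) y = 0.
Proof. exact: (lin0 ((omul_bilinear A n m).1 y)). Qed.
Lemma omul0r n m (x : OA A n) : omul x (0 : OA A m) = 0.
Proof. exact: (lin0 ((omul_bilinear A n m).2 x)). Qed.
Lemma castOD n m (e : n = m) (x y : OA A n) : castO e (x + y) = castO e x + castO e y.
Proof. by case: m / e. Qed.
Lemma castOB n m (e : n = m) (x y : OA A n) : castO e (x - y) = castO e x - castO e y.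
Proof. by case: m / e. Qed.
Lemma oactD n (s t : 'S_n) (x y : OA A n) :
  oact s t (x + y) = oact s t x + oact s t y.
Proof. exact: (linD (oact_linear s t)). Qed.
Lemma opiD n (x y : OA A n.+1) : opi (x + y) = opi x + opi y.
Proof. exact: (linD (@opi_linear k A n)). Qed.
Lemma opureDl n (x y : tpow A n) f (u : 'S_n) :
  opure (x + y) f u = opure x f u + opure y f u.
Proof. exact: (linD (@opure_linearl k A n f u)). Qed.
Lemma opureDr n (x : tpow A n) f g (u : 'S_n) :
  opure x (f + g) u = opure x f u + opure x g u.
Proof. exact: (linD (@opure_linearr k A n x u)). Qed.
Lemma AdD n (s : 'S_n) (x y : OA A n) : Ad s (x + y) = Ad s x + Ad s y.
Proof. exact: (linD (oact_linear s s^-1)). Qed.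
Lemma AdB n (s : 'S_n) (x y : OA A n) : Ad s (x - y) = Ad s x - Ad s y.
Proof. exact: (linB (oact_linear s s^-1)). Qed.

Lemma fact_cat n m (s : 'S_n) (t : 'S_m) (a : {ffun 'I_n -> A}) (b : {ffun 'I_m -> A}) :
  fact (pcat s t) (fcat a b) = fcat (fact s a) (fact t b).
Proof.
apply/ffunP => i; rewrite [LHS]ffunE; have := permKV (pcat s t) i.
move: ((pcat s t)^-1%g i) => j <-; move: j; apply: ord_addP => j;
by rewrite ?(pcatl, pcatr) ?(fcatl, fcatr) ffunE permK.
Qed.

Lemma tact_cat n m (s : 'S_n) (t : 'S_m) (x : tpow A n) (y : tpow A m) :
  tact (pcat s t) (tcat x y) = tcat (tact s x) (tact t y).
Proof.
move: x; apply: ptens_eq; [lin|lin|move=> a].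
move: y; apply: ptens_eq; [lin|lin|move=> b].
by rewrite !tactE !tcatE tactE fact_cat.
Qed.

Lemma pcatM n m (u u' : 'S_n) (v v' : 'S_m) :
  (pcat u v * pcat u' v')%g = pcat (u * u')%g (v * v')%g.
Proof.
by apply/permP; apply: ord_addP => i; rewrite !permM ?(pcatl, pcatr) permM.
Qed.

Lemma oact_mul n m (s t : 'S_n) (s' t' : 'S_m) (x : OA A n) (y : OA A m) :
  omul (oact s t x) (oact s' t' y) = oact (pcat s s') (pcat t t') (omul x y).
Proof.
move: x; apply: OA_eqp; [lin|lin|move=> a f u].
move: y; apply: OA_eqp; [lin|lin|move=> b g v].
by rewrite !oactE !omulE oactE tact_cat !pcatM.
Qed.

Lemma ord0_lshift n m : (ord0 : 'I_(n + m).+1) = lshift m (ord0 : 'I_n.+1).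
Proof. exact: val_inj. Qed.
Lemma lift0_lshift n m (i : 'I_n) :
  lift (ord0 : 'I_(n + m).+1) (lshift m i) = lshift m (lift ord0 i).
Proof. exact: val_inj. Qed.
Lemma lift0_rshift n m (i : 'I_m) :
  lift (ord0 : 'I_(n + m).+1) (rshift n i) = rshift n.+1 i.
Proof. exact: val_inj. Qed.

Lemma lshift_eq0 n m (i : 'I_n.+1) :
  ((lshift m i : 'I_(n + m).+1) == ord0) = (i == ord0).
Proof. by []. Qed.
Lemma rshift_eq0 n m (i : 'I_m) : ((rshift n.+1 i : 'I_(n + m).+1) == ord0) = false.
Proof. by []. Qed.

Lemma pstarE n (u : 'S_n.+1) j : let i := lift ord0 j in
  lift ord0 (pstar u j) = if u i != ord0 then u i else u (u i).
Proof. by rewrite permE; apply: pstar_funE. Qed.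

(* The degrees n.+1 + m and (n + m).+1 are convertible, but they are different
   terms; the type ascriptions and explicit proof terms below choose between
   them. *)
Lemma pstar_cat n m (u : 'S_n.+1) (v : 'S_m) :
  @pstar (n + m) (pcat u v) = pcat (pstar u) v.
Proof.
pose w : 'S_(n + m).+1 := pcat u v; rewrite -[pcat u v]/w.
have wl i : w (@lshift n.+1 m i) = @lshift n.+1 m (u i) by exact (pcatl u v i).
have wr i : w (@rshift n.+1 m i) = @rshift n.+1 m (v i) by exact (pcatr u v i).
move: w wl wr => w wl wr.
apply/permP; apply: ord_addP => i; apply: (@lift_inj _ ord0); rewrite pstarE.
  by rewrite pcatl !lift0_lshift wl pstarE lshift_eq0; case: ifP => // _; rewrite wl.
by rewrite pcatr !lift0_rshift wr rshift_eq0.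
Qed.

Lemma fcatSl n m (a : {ffun 'I_n.+1 -> A}) (b : {ffun 'I_m -> A}) i :
  (fcat a b : {ffun 'I_(n + m).+1 -> A}) (@lshift n.+1 m i) = a i.
Proof. exact (fcatl a b i). Qed.
Lemma fcatSr n m (a : {ffun 'I_n.+1 -> A}) (b : {ffun 'I_m -> A}) i :
  (fcat a b : {ffun 'I_(n + m).+1 -> A}) (@rshift n.+1 m i) = b i.
Proof. exact (fcatr a b i). Qed.

Lemma fcatS0 n m (a : {ffun 'I_n.+1 -> A}) (b : {ffun 'I_m -> A}) :
  (fcat a b : {ffun 'I_(n + m).+1 -> A}) ord0 = a ord0.
Proof. by rewrite ord0_lshift fcatSl. Qed.

Lemma ftail_cat n m (a : {ffun 'I_n.+1 -> A}) (b : {ffun 'I_m -> A}) :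
  @ftail k A (n + m) (fcat a b) = fcat (ftail a) b.
Proof.
apply/ffunP; apply: ord_addP => i; rewrite [LHS]ffunE.
  by rewrite lift0_lshift fcatSl fcatl ffunE.
by rewrite lift0_rshift fcatSr fcatr.
Qed.

Lemma fmerge0_cat n m (j : 'I_n.+1) (a : {ffun 'I_n.+1 -> A}) (b : {ffun 'I_m -> A}) :
  @fmerge k A (n + m) ord0 (lshift m j) (fcat a b) = fcat (fmerge ord0 j a) b.
Proof.
apply/ffunP; apply: ord_addP => i; rewrite [LHS]ffunE.
  by rewrite lift0_lshift [X in X * _]fcatS0 !fcatSl fcatl ffunE.
rewrite lift0_rshift fcatSr fcatr; case: eqP => // /(congr1 val) /= e.
by have := ltn_ord j; lia.
Qed.

Lemma opi_mul_linearl n m (y : OA A m) :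
  linear (fun x : OA A n.+1 => @opi k A (n + m) (omul x y)).
Proof.
have mL : linear (fun x : OA A n.+1 => omul x y : OA A (n + m).+1).
  exact ((omul_bilinear A n.+1 m).1 y).
move=> c x z; refine (etrans (congr1 (@opi k A (n + m)) (mL c x z)) _).
exact (opi_linear c _ _).
Qed.
Lemma opi_mul_linearr n m (x : OA A n.+1) :
  linear (fun y : OA A m => @opi k A (n + m) (omul x y)).
Proof.
have mL : linear (fun y : OA A m => omul x y : OA A (n + m).+1).
  exact ((omul_bilinear A n.+1 m).2 x).
move=> c y z; refine (etrans (congr1 (@opi k A (n + m)) (mL c y z)) _).
exact (opi_linear c _ _).
Qed.

(** pi depends only on the first letter and on the position to which the
    permutation sends it, and both belong to the left factor. *)
Lemma opi_mul n m (x : OA A n.+1) (y : OA A m) :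
  @opi k A (n + m) (omul x y) = omul (opi x) y.
Proof.
move: x; apply: OA_eqp; [exact: opi_mul_linearl|lin|move=> a f u].
move: y; apply: OA_eqp; [exact: opi_mul_linearr|lin|move=> b g v].
pose w : 'S_(n + m).+1 := pcat u v.
pose c : {ffun 'I_(n + m).+1 -> A} := fcat a b.
have -> : omul (opure (ptens a) f u) (opure (ptens b) g v)
        = opure (ptens c) (f * g) w by rewrite omulE tcatE.
have w0 : w ord0 = @lshift n.+1 m (u ord0) by rewrite ord0_lshift; exact (pcatl u v ord0).
have [u0|u0] := eqVneq (u ord0) ord0.
  rewrite (@opiE_fixed k A (n + m)); last by rewrite w0 u0; apply: val_inj.
  by rewrite opiE_fixed // omulE tcatE ftail_cat pstar_cat fcatS0 mulrA.
rewrite (@opiE_moved k A (n + m)) w0; last by rewrite lshift_eq0.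
by rewrite opiE_moved // omulE tcatE fmerge0_cat pstar_cat.
Qed.
End Calculus.

(** * The bracket of a derivation of O(A) *)
Section Bracket.
Variables (k : fieldType) (A : algType k).

(** The properties of y |-> br 1 y that make x d(y) - d(x) y a bracket. *)
Record OA_derivation (d : forall n, OA A n -> OA A n) : Prop := {
  der_linear n : linear (d n);
  der_mul n m (x : OA A n) (y : OA A m) :
    d (n + m)%N (omul x y) = omul x (d m y) + omul (d n x) y;
  der_act n (s t : 'S_n) x : d n (oact s t x) = oact s t (d n x);
  der_pi n (x : OA A n.+1) : d n (opi x) = opi (d n.+1 x);
  der_unit : d 1 (hat (t1 1)) = 0
}.

Definition dbracket (d : forall n, OA A n -> OA A n) : obracket A :=
  fun n m x y => omul x (d m y) - omul (d n x) y.

Lemma omul1A n m (w : OA A 1) (x : OA A n) (y : OA A m) :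
  omul (omul w x) y = omul w (omul x y) :> OA A (1 + (n + m)).
Proof. exact (etrans (esym (castO_id _ _)) (omulA w x y)). Qed.

Lemma telescope3 (V : zmodType) (a b c : V) : (a - b) + (c - a) + (b - c) = 0.
Proof. by rewrite [a - b + _]addrC !subrKA subrr. Qed.

Lemma jacobi_cancel (V : zmodType) (a b c e f g : V) :
  a - b - (c - e) + (f - a - (e - g)) + (b - f - (g - c)) = 0.
Proof.
rewrite (addrACA (a - b)) (addrACA (a - b + (f - a))) telescope3 add0r -!opprD.
by rewrite [c - e + _]addrC telescope3 oppr0.
Qed.

Lemma leibniz_cancel (V : zmodType) (a b c : V) :
  a - (b + c) + (a + c - b) = (a - b) *+ 2.
Proof. by rewrite opprD (addrA a (- b)) [a + c]addrC -(addrA c a) subrKA mulr2n. Qed.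

Section FromDerivation.
Variable d : forall n, OA A n -> OA A n.
Hypothesis dD : OA_derivation d.

Let dB n (x y : OA A n) : d (x - y) = d x - d y.
Proof. exact: (linB (der_linear dD (n := n))). Qed.

(** The cross terms d(x) d(y) cancel, as for a Wronskian. *)
Lemma der_dbracket n m (x : OA A n) (y : OA A m) :
  d (dbracket d x y) = omul x (d (d y)) - omul (d (d x)) y.
Proof. by rewrite /dbracket dB !(der_mul dD) opprD addrA addrK. Qed.

Lemma dbracket2 n m p (x : OA A n) (y : OA A m) (z : OA A p) :
  dbracket d x (dbracket d y z)
  = omul x (omul y (d (d z))) - omul x (omul (d (d y)) z)
    - (omul (d x) (omul y (d z)) - omul (d x) (omul (d y) z)).
Proof. by rewrite {1}/dbracket der_dbracket /dbracket !omulBr. Qed.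

Lemma der_hat1 n (x : OA A n) : d (hat1 x) = hat1 (d x).
Proof. by rewrite /hat1 (der_mul dD) (der_unit dD) omul0l addr0. Qed.

(** In the Jacobi sum each of the six products of x, y, z with two
    derivatives occurs twice with opposite signs. The axioms in the first
    variable hold since pi and the multiplication by the letter 1 commute both
    with d and with right multiplications. *)
Lemma dbracket_dtp : double_transposed_Poisson (dbracket d).
Proof.
split.
- move=> n m; have dL := der_linear dD (n := n); have dL' := der_linear dD (n := m).
  have mL x : linear (fun y : OA A m => omul x (d y)) := lin_omulr x dL'.
  have mL' y : linear (fun x : OA A n => omul (d x) y) := lin_omull y dL.
  by split=> [y|x] /=; rewrite /dbracket; lin.
- move=> n m s t s' t' x y; rewrite /dbracket !(der_act dD) !oact_mul.
  by rewrite (linB (oact_linear _ _)).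
- by move=> n m x y; rewrite /dbracket AdB castOB !omul_swap opprB.
- move=> n m p x y z; rewrite !dbracket2 !AdB !castOB !omul_rot123 !omul_rot132.
  exact: jacobi_cancel.
- move=> n m p x y z; rewrite /dbracket !(der_mul dD) omulDl omulBr omulDr.
  rewrite castOB castOD !omulA AdB castOB AdD castOD !omul_swap12.
  by rewrite leibniz_cancel scaler_nat.
- move=> n m x y; rewrite /dbracket (der_pi dD) -!opi_mul.
  exact (esym (linB (@opi_linear k A (n + m)%N) _ _)).
- by move=> n m x y; rewrite /dbracket der_hat1 /hat1 omulBr !omul1A.
Qed.
End FromDerivation.
End Bracket.

(** * The derivation of a bracket *)
Section FromBracket.
Variables (k : fieldType) (A : algType k).

Lemma bperm_s12_0 p N : (p <= N)%N -> bperm s12 [tuple 0%N; p] N = 1%g.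
Proof.
move=> pN; apply/permP => i; rewrite perm1; have [ip|pi] := ltnP i p.
  by apply/val_inj; rewrite /= (s12_snd _ ip).
by rewrite s12_out.
Qed.

Lemma tact1 n (x : tpow A n) : tact 1%g x = x.
Proof.
move: x; apply: ptens_eq; [lin|exact: lin_id|move=> a].
by rewrite tactE; congr ptens; apply/ffunP => i; rewrite ffunE invg1 perm1.
Qed.

Lemma oact1 n (x : OA A n) : oact 1%g 1%g x = x.
Proof.
move: x; apply: OA_eqp; [lin|exact: lin_id|move=> a f u].
by rewrite oactE tact1 mul1g mulg1.
Qed.

Lemma twice_inj (V : lmodType k) : (2%:R : k) != 0 -> injective (fun x : V => x *+ 2).
Proof. by move=> two x y /=; rewrite -!scaler_nat => /(scalerI two). Qed.

Hypothesis two : (2%:R : k) != 0.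
Variable br : obracket A.
Hypothesis brP : double_transposed_Poisson br.

Definition bder n : OA A n -> OA A n := br (oone A).

Lemma bder_linear n : linear (@bder n).
Proof. exact: ((dtp_bilinear brP 0 n).2 (oone A)). Qed.

Lemma bder_act n (s t : 'S_n) x : bder (oact s t x) = oact s t (bder x).
Proof.
have := dtp_bimodule brP 1%g 1%g s t (oone A) x.
by rewrite oact1 !pcat0.
Qed.

Lemma bder_Ad n (s : 'S_n) x : bder (Ad s x) = Ad s (bder x).
Proof. exact: bder_act. Qed.

Lemma castO_irr n m (e e' : n = m) (x : OA A n) : castO e x = castO e' x.
Proof. by rewrite (eq_irrelevance e e'). Qed.

Lemma bder_cast n m (e : n = m) x : bder (castO e x) = castO e (bder x).
Proof. by case: m / e. Qed.

Lemma br_castl n n' m (e : n = n') (e' : (n + m = n' + m)%N) (x : OA A n) (y : OA A m) :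
  br (castO e x) y = castO e' (br x y).
Proof. by case: n' / e e' => e'; rewrite !castO_id. Qed.

(** The Leibniz identity with the unit in the first slot, where its block
    permutation exchanges z with an empty block. *)
Lemma br_Leibniz0 p m (z : OA A p) (y : OA A m) :
  omul z (bder y) *+ 2 = br z y + bder (omul z y).
Proof.
have e1 : castO (esym (addnA p 0 m)) (br (omul z (oone A)) y) = br z y :> OA A (p + m).
  have e' : (p + 0 + m = p + m)%N by rewrite addn0.
  rewrite -[in RHS](omul1r z) (br_castl _ e').
  exact (castO_irr _ _ _).
have e2 : castO (addnCA 0 p m) (Ad (bperm s12 [tuple 0%N; p] (0 + (p + m)))
    (br (oone A) (omul z y))) = bder (omul z y) :> OA A (p + m).
  rewrite castO_id bperm_s12_0 ?add0n ?leq_addr //.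
  by rewrite /Ad invg1 oact1.
have L := dtp_Leibniz brP (oone A) y z; rewrite scaler_nat in L.
exact: (etrans L (f_equal2 +%R e1 e2)).
Qed.

Lemma brE p m (z : OA A p) (y : OA A m) :
  br z y = omul z (bder y) *+ 2 - bder (omul z y).
Proof. by rewrite br_Leibniz0 addrK. Qed.

(** Antisymmetry compares brE for (x, y) and (y, x), and gives
    2 d(x y) = 2 (x d(y) + d(x) y). *)
Lemma bder_mul n m (x : OA A n) (y : OA A m) :
  bder (omul x y) = omul x (bder y) + omul (bder x) y.
Proof.
apply: (twice_inj two); rewrite /= mulrnDl.
have := dtp_antisym brP y x; rewrite !brE AdB castOB !mulr2n AdD castOD.
rewrite omul_swap -bder_Ad -bder_cast omul_swap opprB => e.
by apply/eqP; rewrite -subr_eq addrAC -e subrK.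
Qed.

Lemma omul1_inj n (x y : OA A n) : omul x (oone A) = omul y (oone A) -> x = y.
Proof. by move=> e; rewrite -(omul1r x) e omul1r. Qed.

Lemma bder_one : bder (oone A) = 0.
Proof.
have := bder_mul (oone A) (oone A); rewrite !omul1l -{1}[bder _]addr0.
by move/addrI => e; apply: omul1_inj; rewrite -e omul0l.
Qed.

Lemma br_dbracket n m (x : OA A n) (y : OA A m) : br x y = dbracket bder x y.
Proof. by rewrite brE bder_mul opprD mulr2n addrA addrK. Qed.

Lemma br_one n (x : OA A n) : br x (oone A) = - omul (bder x) (oone A).
Proof. by rewrite br_dbracket /dbracket bder_one omul0r add0r. Qed.

(** By br_one the axioms on pi and on the letter 1 in the first variable are
    statements about d, once the second variable is the unit. *)
Lemma bder_derivation : OA_derivation bder.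
Proof.
split; [exact: bder_linear|exact: bder_mul|exact: bder_act| |].
  move=> n x; apply: omul1_inj; apply: oppr_inj; rewrite -br_one -opi_mul.
  have L := dtp_pi brP x (oone A).
  refine (etrans L _); rewrite br_one.
  exact (linN (@opi_linear k A (n + 0)) _).
apply: omul1_inj; have e : hat1 (oone A) = hat (t1 1) :> OA A 1.
  exact (etrans (esym (castO_id _ _)) (omul1r (hat (t1 1)))).
have := dtp_hat1 brP (oone A) (oone A); rewrite !br_one bder_one.
rewrite !omul0l oppr0 /hat1 omul0r => /eqP; rewrite oppr_eq0 => /eqP L.
rewrite -e; exact L.
Qed.
End FromBracket.

(** * Derivations of tensor powers and of symmetric algebras *)
Section TensorDerivation.
Variables (k : fieldType) (A : algType k) (D : A -> A).
Hypothesis DL : linear D.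

Lemma ptens_linear n (a : {ffun 'I_n -> A}) i :
  linear (fun b => ptens (upd a i b)).
Proof. exact: ptens_multilinear. Qed.

Lemma tder_cat n m (x : tpow A n) (y : tpow A m) :
  tder D (tcat x y) = tcat x (tder D y) + tcat (tder D x) y.
Proof.
move: x; apply: ptens_eq; [by lin|by lin|move=> a].
move: y; apply: ptens_eq; [by lin|by lin|move=> b].
rewrite tcatE !tderE // [RHS]addrC.
rewrite (lin_sum ((tcat_bilinear A n m).1 (ptens b))).
rewrite (lin_sum ((tcat_bilinear A n m).2 (ptens a))) big_split_ord.
congr (_ + _); apply: eq_bigr => i _; first by rewrite fcatl tcatE fcat_updl.
by rewrite fcatr tcatE fcat_updr.
Qed.

Lemma tder_act n (s : 'S_n) (x : tpow A n) : tder D (tact s x) = tact s (tder D x).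
Proof.
move: x; apply: ptens_eq; [by lin|by lin|move=> a].
rewrite tactE !tderE // (lin_sum (tact_linear s)) (reindex_inj (@perm_inj _ s)).
apply: eq_bigr => i _.
by rewrite tactE fact_upd [X in D X]ffunE permK.
Qed.

Lemma tder_t1 a : tder D (t1 a) = t1 (D a).
Proof.
rewrite /t1 tderE // big_ord1; congr ptens; apply/ffunP => i.
by rewrite !ffunE !ord1.
Qed.

Lemma tder_ins n (r : 'I_n.+1) (x : tpow A n) : D 1 = 0 ->
  tder D (tins r 1 x) = tins r 1 (tder D x).
Proof.
move=> D1; move: x; apply: ptens_eq; [by lin|by lin|move=> a].
rewrite tinsE !tderE // (lin_sum (tins_linear r 1)) (bigD1_ord r) //=.
rewrite [X in D X]ffunE unlift_none D1 (lin0 (@ptens_linear _ _ _)) add0r.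
by apply: eq_bigr => i _; rewrite tinsE fins_upd [X in D X]ffunE liftK.
Qed.

(** By the Leibniz rule the merged letter a_u a_v accounts for the two terms
    in which D acts on position u or on position v. *)
Lemma tder_merge n (u v : 'I_n.+1) (x : tpow A n.+1) : u != v ->
  (forall a b, D (a * b) = a * D b + D a * b) ->
  tder D (tmerge u v x) = tmerge u v (tder D x).
Proof.
move=> uv DM; have mL := @tmerge_linear k A n u v uv.
move: x; apply: ptens_eq; [by lin|by lin|move=> a].
have [j ej] : exists j, v = lift u j by case: (unlift_some uv) => j ->; exists j.
rewrite tmergeE // !tderE // (lin_sum mL) (bigD1_ord u) //=.
rewrite tmergeE // fmerge_upd // unlift_none ej liftK.
rewrite (bigD1 j) //= [in RHS](bigD1 j) //= addrA; congr (_ + _).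
  rewrite [X in D X]ffunE eqxx DM (linD (@ptens_linear _ _ _)) addrC.
  by rewrite tmergeE -?ej // fmerge_upd // ej liftK eqxx.
apply: eq_bigr => i ij; rewrite tmergeE -?ej // fmerge_upd // liftK ej.
by rewrite [X in D X]ffunE (inj_eq (@lift_inj _ u)) (negPf ij).
Qed.
End TensorDerivation.

Section SymmetricDerivation.
Variables (k : fieldType) (V : lmodType k) (E : V -> V).
Hypothesis EL : linear E.

(* Removing the value v, not a position, keeps the sum invariant under
   permutations of s; repeated entries give equal terms. *)
Let F (s : seq V) : symalg V := \sum_(v <- s) symm (E v :: rem v s).

Definition sder : symalg V -> symalg V := plift F.

Lemma symm_cons (v : V) s : symm (v :: s) = sym_gen v * symm s.
Proof. by rewrite !symmE big_cons. Qed.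

Lemma sym_gen_linear : linear (@sym_gen k V).
Proof. by move=> c u v; rewrite /sym_gen symm_lin. Qed.

Let F_cons u s : F (u :: s) = sym_gen (E u) * symm s + sym_gen u * F s.
Proof.
rewrite /F big_cons /= eqxx symm_cons mulr_sumr; congr (_ + _).
apply: eq_big_seq => v vs; rewrite -symm_cons; apply: symm_perm.
rewrite perm_sym -[u :: E v :: _]/([:: u] ++ [:: E v] ++ _) perm_catCA /= perm_cons.
by case: eqP => // ->; rewrite perm_sym perm_to_rem.
Qed.

Let F_perm s t : perm_eq s t -> F s = F t.
Proof.
move=> st; rewrite /F (perm_big _ st); apply: eq_big_seq => v vt.
apply: symm_perm; rewrite perm_cons -(perm_cons v).
have vs : v \in s by rewrite (perm_mem st).
by rewrite -(permPl (perm_to_rem vs)); apply: perm_trans st (perm_to_rem vt).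
Qed.

Let F_lin s : linear (fun u => F (u :: s)).
Proof.
move=> c u v; rewrite !F_cons EL !sym_gen_linear !mulrDl -!scalerAl scalerDr.
by rewrite addrACA.
Qed.

Lemma sder_linear : linear sder.
Proof. exact: sym_lift_linear. Qed.

Let sderE s : sder (symm s) = F s.
Proof. exact: sym_liftE. Qed.

Lemma sder1 : sder 1 = 0.
Proof. by rewrite -[1]/(symm [::]) sderE /F big_nil. Qed.

Let sder_gen_mul u f : sder (sym_gen u * f) = sym_gen (E u) * f + sym_gen u * sder f.
Proof.
elim/sym_ind: f => [|c s f IH]; first by rewrite !mulr0 (lin0 sder_linear) mulr0 addr0.
rewrite !mulrDr !(linD sder_linear) IH mulrDr addrACA; congr (_ + _).
rewrite -!scalerAr !(linZ sder_linear) -!scalerAr -scalerDr; congr (_ *: _).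
by rewrite -symm_cons !sderE F_cons.
Qed.

Lemma sder_gen u : sder (sym_gen u) = sym_gen (E u).
Proof. by rewrite -[sym_gen u]mulr1 sder_gen_mul sder1 mulr0 addr0 mulr1. Qed.

Lemma sder_mul f g : sder (f * g) = f * sder g + sder f * g.
Proof.
elim/sym_ind: f => [|c s f IH]; first by rewrite !mul0r (lin0 sder_linear) mul0r addr0.
rewrite !mulrDl !(linD sder_linear) IH mulrDl addrACA; congr (_ + _).
rewrite -!scalerAl !(linZ sder_linear) -!scalerAl -scalerDr; congr (_ *: _).
elim: s => [|u s IHs]; first by rewrite (_ : symm [::] = 1) // !mul1r sder1 mul0r addr0.
rewrite symm_cons -mulrA !sder_gen_mul IHs mulrDl mulrDr !mulrA.
by rewrite addrCA addrA addrC addrA.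
Qed.
End SymmetricDerivation.

(** * The extension of a derivation of A to O(A) *)
Section Extension.
Variables (k : fieldType) (A : algType k).

Lemma cls_linear : linear (@cls k A).
Proof. exact: linearP. Qed.

Lemma cls_mulC (a b : A) : cls (a * b) = cls (b * a).
Proof.
apply/projP; rewrite -[X in Defs.span _ X]addr0 -[X in Defs.span _ (X + _)]scale1r.
by apply: Defs.spanS; [exists a, b|exact: Defs.span0].
Qed.

Lemma opi_moved n (x : tpow A n.+1) f (u : 'S_n.+1) : u ord0 != ord0 ->
  opi (opure x f u) = opure (tmerge ord0 (u ord0) x) f (pstar u).
Proof.
move=> u0; have mL : linear (@tmerge k A n ord0 (u ord0)).
  by apply: tmerge_linear; rewrite eq_sym.
move: x; apply: ptens_eq; [by lin|by lin|move=> a].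
by rewrite opiE_moved // tmergeE // eq_sym.
Qed.

Variable D : A -> A.
Hypothesis DL : linear D.
Hypothesis DM : forall a b, D (a * b) = a * D b + D a * b.

Lemma der1 : D 1 = 0.
Proof. by apply: (@addrI _ (D 1)); rewrite addr0 -[in RHS](mulr1 1) DM mulr1 mul1r. Qed.

(** D on A_nat; the Leibniz rule makes D preserve the span of commutators. *)
Definition nder : Anat A -> Anat A := qlift (fun a => cls (D a)).

Let clsD_linear : linear (fun a => cls (D a)).
Proof. exact: lin_comp cls_linear DL. Qed.
Let clsD_comm r : Defs.commutator r -> cls (D r) = 0.
Proof.
case=> a [b ->]; rewrite (linB DL) !DM opprD addrACA.
rewrite (linD cls_linear) !(linB cls_linear).
by rewrite (cls_mulC a) (cls_mulC (D a)) subrKA subrr.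
Qed.

Lemma nder_linear : linear nder.
Proof. exact: qlift_linear. Qed.
Lemma nder_cls a : nder (cls a) = cls (D a).
Proof. exact: qliftE. Qed.

(** Leibniz rule for the factors A^n and S(A_nat); permutations are constants.
*)
Definition oder n : OA A n -> OA A n :=
  OA_lift (fun x f u => opure (tder D x) f u + opure x (sder nder f) u).

Let oder_multi n :
  (forall f (u : 'S_n), linear (fun x : tpow A n =>
     opure (tder D x) f u + opure x (sder nder f) u)) *
  (forall (x : tpow A n) (u : 'S_n), linear (fun f =>
     opure (tder D x) f u + opure x (sder nder f) u)).
Proof.
have sL := sder_linear nder_linear.
by split=> *; lin.
Qed.

Lemma oderE n x f (u : 'S_n) :
  oder (opure x f u) = opure (tder D x) f u + opure x (sder nder f) u.
Proof. by have [m1 m2] := oder_multi n; apply: OA_liftE. Qed.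
Lemma oder_linear n : linear (@oder n).
Proof. by have [m1 m2] := oder_multi n; apply: OA_lift_linear. Qed.

Lemma opure0 n (x : tpow A n) (u : 'S_n) : opure x 0 u = 0.
Proof. exact: (lin0 (@opure_linearr _ _ n x u)). Qed.

Lemma oder_hat n (x : tpow A n) : oder (hat x) = hat (tder D x).
Proof. by rewrite /hat oderE (sder1 nder_linear) opure0 addr0. Qed.

Lemma lin_oder (V : lmodType k) n (g : V -> OA A n) :
  linear g -> linear (fun x => oder (g x)).
Proof. exact: (lin_comp (@oder_linear n)). Qed.

Lemma oder_mul n m (x : OA A n) (y : OA A m) :
  oder (omul x y) = omul x (oder y) + omul (oder x) y.
Proof.
have oLn := @oder_linear n; have oLm := @oder_linear m.
move: x; apply: OA_eqp; [apply: lin_oder; lin|apply: lin_add; lin|move=> a f u].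
move: y; apply: OA_eqp; [apply: lin_oder; lin|apply: lin_add; lin|move=> b g v].
rewrite omulE !oderE omulDl omulDr !omulE tder_cat // (sder_mul nder_linear).
by rewrite opureDl opureDr addrACA.
Qed.

Lemma oder_act n (s t : 'S_n) (x : OA A n) : oder (oact s t x) = oact s t (oder x).
Proof.
have oL := @oder_linear n.
move: x; apply: OA_eqp.
- by apply: lin_oder; lin.
- by apply: lin_oact; lin.
move=> a f u.
by rewrite oactE [LHS]oderE [in RHS]oderE oactD !oactE tder_act.
Qed.

Lemma ftail_upd0 n (a : {ffun 'I_n.+1 -> A}) b : ftail (upd a ord0 b) = ftail a.
Proof. by apply/ffunP => j; rewrite !ffunE. Qed.
Lemma ftail_updS n (a : {ffun 'I_n.+1 -> A}) i b :
  ftail (upd a (lift ord0 i) b) = upd (ftail a) i b.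
Proof. by apply/ffunP => j; rewrite !ffunE (inj_eq (@lift_inj _ ord0)). Qed.

(** If the first letter is fixed, the term where D acts on it gives the
    derivative of the new factor of S(A_nat); otherwise this is tder_merge. *)
Lemma oder_pi n (x : OA A n.+1) : oder (opi x) = opi (oder x).
Proof.
have oL := oder_linear.
move: x; apply: OA_eqp.
- by apply: lin_oder; lin.
- by apply: lin_opi; exact: oL.
move=> a f u.
have [u0|u0] := eqVneq (u ord0) ord0; last first.
  rewrite opi_moved // !oderE opiD !opi_moved //.
  by rewrite tder_merge // eq_sym.
rewrite opiE_fixed // !oderE opiD opiE_fixed //.
rewrite (sder_mul nder_linear) (sder_gen nder_linear) nder_cls.
rewrite !tderE // !(lin_sum (@opure_linearl _ _ _ _ _)) (lin_sum (@opi_linear _ _ n)).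
rewrite opureDr big_ord_recl opiE_fixed // ftail_upd0.
rewrite ffunE eqxx [RHS]addrAC [RHS]addrC [X in _ = _ + X]addrC; congr (_ + _).
by apply: eq_bigr => i _; rewrite opiE_fixed // ftail_updS !ffunE.
Qed.

Lemma oder_derivation : OA_derivation oder.
Proof.
split; [exact: oder_linear|exact: oder_mul|exact: oder_act|exact: oder_pi|].
rewrite oder_hat tder_t1 // der1 /hat (lin0 (@t1_linear k A)).
exact: (lin0 (@opure_linearl _ _ _ _ _)).
Qed.
End Extension.

(** * Generation of O(A) by A *)
Section Generation.
Variables (k : fieldType) (A : algType k).

Lemma fcat0 n (a : {ffun 'I_0 -> A}) (b : {ffun 'I_n -> A}) : fcat a b = b.
Proof.
apply/ffunP => i; have e (j : 'I_n) : rshift 0 j = j by exact: val_inj.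
by rewrite -[i in LHS]e fcatr.
Qed.

Lemma ptens0 (a : {ffun 'I_0 -> A}) : ptens a = tone0 A.
Proof. by congr ptens; apply/ffunP => -[]. Qed.

Lemma ptens_cons n (a : {ffun 'I_n.+1 -> A}) :
  ptens a = tcat (t1 (a ord0)) (ptens (ftail a)).
Proof.
rewrite /t1 tcatE; congr ptens; apply/ffunP.
apply: (@ord_addP 1 n) => i.
  refine (etrans _ (esym (fcatl [ffun => a ord0] (ftail a) i))).
  by rewrite ffunE (ord1 i); congr (a _); apply: val_inj.
refine (etrans _ (esym (fcatr [ffun => a ord0] (ftail a) i))).
by rewrite ffunE; congr (a _); apply: val_inj.
Qed.

Lemma der_one d : OA_derivation d -> d 0 (oone A) = 0.
Proof.
move=> dD; have := der_mul dD (oone A) (oone A); rewrite !omul1l -{1}[d _ _]addr0.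
by move/addrI => e; apply: omul1_inj; rewrite -e omul0l.
Qed.

(** A factor cls b is produced by pi from a new first letter b that the
    permutation fixes. *)
Lemma opure_opi n (a : {ffun 'I_n -> A}) b f (u : 'S_n) :
  opure (ptens a) (sym_gen (cls b) * f) u
  = opi (opure (tcat (t1 b) (ptens a)) f (pcat (1%g : 'S_1) u) : OA A n.+1).
Proof.
pose c : {ffun 'I_n.+1 -> A} := @fcat k A 1 n [ffun => b] a.
pose w : 'S_n.+1 := @pcat 1 n 1%g u.
have c0 : c ord0 = b by rewrite [c _]fcatS0 ffunE.
have w0 : w ord0 = ord0.
  rewrite [X in w X](@ord0_lshift 0 n).
  by apply: (etrans (pcatl (1%g : 'S_1) u ord0)); rewrite perm1; apply: val_inj.
have ct : ftail c = a by rewrite (@ftail_cat _ _ 0 n) fcat0.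
have ws : pstar w = u by rewrite (@pstar_cat 0 n) pcat0.
have e : opure (tcat (t1 b) (ptens a)) f (pcat 1%g u) = opure (ptens c) f w :> OA A n.+1.
  by rewrite /t1 tcatE.
refine (esym (etrans (congr1 (@opi k A n) e) _)).
by rewrite (opiE_fixed c f w0) ct ws c0.
Qed.

Variables d e : forall n, OA A n -> OA A n.
Hypotheses (dD : OA_derivation d) (eD : OA_derivation e).
Hypothesis de : forall a, d (hat (t1 a)) = e (hat (t1 a)).

(** Products and permutations generate the elements with trivial coefficient
    in S(A_nat), and opure_opi adds the factors of the coefficient one at a
    time. *)
Lemma der_ext n (x : OA A n) : d x = e x.
Proof.
have dL := der_linear dD; have eL := der_linear eD.
have hatP m (a : {ffun 'I_m -> A}) : d (hat (ptens a)) = e (hat (ptens a)).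
  elim: m a => [|m IH] a; first by rewrite ptens0 !der_one.
  rewrite ptens_cons (hat_cat (t1 _)).
  have /= := der_mul dD (hat (t1 (a ord0))) (hat (ptens (ftail a))).
  by rewrite IH de -(der_mul eD).
move: x; apply: OA_eqp => // a f u.
elim/sym_ind: f a u => [|c s f IH] a u; first by rewrite opure0 (lin0 (dL n)) (lin0 (eL n)).
rewrite (@opure_linearr _ _ n) dL eL IH.
suff -> : d (opure (ptens a) (symm s) u) = e (opure (ptens a) (symm s) u) by [].
move=> {f IH}.
elim: s n a u => [|v s IH] n a u.
  have -> : opure (ptens a) (symm [::]) u = oact 1%g u (hat (ptens a)).
    by rewrite /hat oactE tact1 !mulg1.
  by rewrite (der_act dD) (der_act eD) hatP.
rewrite symm_cons -(proj_repr v) -/(cls _) opure_opi (der_pi dD) (der_pi eD).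
by rewrite /t1 tcatE IH.
Qed.
End Generation.

(** * Tensor powers: block permutations, insertions, multiplications *)
Section BlockLemmas.
Local Open Scope nat_scope.
Variables (l : nat) (tau : 'S_l) (d : l.-tuple nat).

Lemma pcat1_0 : (pcat (1%g : 'S_1) tau : 'S_l.+1) ord0 = ord0.
Proof.
rewrite [X in fun_of_perm _ X](_ : ord0 = @lshift 1 l ord0); last exact: val_inj.
by apply: (etrans (pcatl (1%g : 'S_1) tau ord0)); rewrite perm1; apply: val_inj.
Qed.

Lemma pcat1_lift j :
  (pcat (1%g : 'S_1) tau : 'S_l.+1) (lift ord0 j) = lift ord0 (tau j).
Proof.
rewrite [X in fun_of_perm _ X](_ : lift ord0 j = @rshift 1 l j); last exact: val_inj.
by apply: (etrans (pcatr (1%g : 'S_1) tau j)); apply: val_inj.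
Qed.

Lemma bperm_right r s : \sum_(i < l) tnth d i = s ->
  bperm (pcat (1%g : 'S_1) tau) [tuple of r :: d] (r + s)
  = pcat (1%g : 'S_r) (bperm tau d s).
Proof.
move=> ds; pose u : 'S_l.+1 := pcat (1%g : 'S_1) tau.
pose d' : l.+1.-tuple nat := [tuple of r :: d].
rewrite -[bperm _ _ _]/(bperm u d' (r + s)).
have u0 : u ord0 = ord0 := pcat1_0.
have uS j : u (lift ord0 j) = lift ord0 (tau j) := pcat1_lift j.
have total : \sum_(i < l.+1) tnth d' i <= r + s.
  by rewrite big_ord_recl tnth0 -ds leq_add2l; apply: leq_sum => i _; rewrite tnthS.
apply/permP; apply: ord_addP => i; apply: val_inj => /=.
  rewrite pcatl perm1 /=; apply: (@bperm_block _ _ _ ord0 i) => //.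
  - by rewrite /old_start big_pred0.
  by rewrite /new_start big_pred0 // => j; rewrite u0.
rewrite pcatr /= [X in _ = _ + X]bpermE ?ds //.
have /block_ex [j [o oj e]] : (i < \sum_(i < l) tnth d i)%N by rewrite ds.
rewrite e block_funE //; apply: (@bperm_block _ _ _ (lift ord0 j) o) => //.
- by rewrite tnthS.
- rewrite /= e addnA; congr (_ + _); rewrite /old_start.
  rewrite [RHS]big_mkcond [RHS]big_ord_recl tnth0.
  by congr (_ + _); rewrite [LHS]big_mkcond; apply: eq_bigr => h _; rewrite tnthS.
rewrite /new_start big_mkcond big_ord_recl u0 uS tnth0 addnA; congr (_ + _ + _).
by rewrite [RHS]big_mkcond; apply: eq_bigr => h _; rewrite !uS tnthS.
Qed.

Lemma bperm_left r s : \sum_(i < l) tnth d i = s ->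
  bperm tau d (s + r) = pcat (bperm tau d s) (1%g : 'S_r).
Proof.
move=> ds; apply/permP; apply: ord_addP => i; apply: val_inj => /=.
  by rewrite pcatl /= !bpermE ?ds ?leq_addr.
by rewrite pcatr perm1 bpermE ?ds ?leq_addr //= block_fun_out ?ds ?leq_addr.
Qed.
End BlockLemmas.

Section Tensors.
Variables (k : fieldType) (A : algType k).

Lemma castT_pure n m (e : n = m) (a : {ffun 'I_n -> A}) (b : {ffun 'I_m -> A}) :
  (forall i, b (cast_ord e i) = a i) -> castT e (ptens a) = ptens b.
Proof.
case: m / e b => b hb; congr ptens; apply/ffunP => i.
by rewrite -hb cast_ord_id.
Qed.

Lemma castT_linear n m (e : n = m) : linear (@castT k A n m e).
Proof. by lin. Qed.

Lemma tcat_swap n m (x : tpow A n) (y : tpow A m) :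
  castT (addnC n m) (tact (bperm s12 [tuple n; m] (n + m)) (tcat x y)) = tcat y x.
Proof. by apply: hat_inj; rewrite -castO_hat -Ad_hat !hat_cat omul_swap. Qed.
Lemma tcat_swap12 n p m (x : tpow A n) (y : tpow A p) (z : tpow A m) :
  castT (addnCA n p m)
    (tact (bperm s12 [tuple n; p] (n + (p + m))) (tcat x (tcat y z)))
  = tcat y (tcat x z).
Proof. by apply: hat_inj; rewrite -castO_hat -Ad_hat !hat_cat omul_swap12. Qed.
Lemma tcat_back n m p (x : tpow A n) (y : tpow A m) (z : tpow A p) :
  castT (addn_back n m p)
    (tact (bperm s132 [tuple n; m; p] (n + m + p)) (tcat (tcat x y) z))
  = tcat (tcat y z) x.
Proof. by apply: hat_inj; rewrite -castO_hat -Ad_hat !hat_cat omul_back. Qed.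
Lemma tcat_swap23 n m p (x : tpow A n) (y : tpow A m) (z : tpow A p) :
  castT (addn_swap n m p)
    (tact (bperm s23 [tuple n; m; p] (n + (m + p))) (tcat x (tcat y z)))
  = tcat (tcat x z) y.
Proof. by apply: hat_inj; rewrite -castO_hat -Ad_hat !hat_cat omul_swap23. Qed.

Lemma finsE n (r : 'I_n.+1) b (a : {ffun 'I_n -> A}) :
  fins r b a r = b /\ forall j, fins r b a (lift r j) = a j.
Proof. by split=> [|j]; rewrite ffunE ?unlift_none ?liftK. Qed.

Lemma tins_catl r s (x : tpow A r) (y : tpow A s) p : (p <= r)%N ->
  tcat (tins (inord p) 1 x) y = tins (inord p : 'I_(r + s).+1) 1 (tcat x y).
Proof.
move=> pr.
have cL : forall y : tpow A s, linear (fun x : tpow A r =>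
    tcat (tins (inord p) 1 x) y : tpow A (r + s).+1).
  by move=> z; exact (lin_tcatl z (tins_linear (inord p) 1)).
have cR : forall x : tpow A r.+1, linear (fun y : tpow A s =>
    tcat x y : tpow A (r + s).+1).
  by move=> z; exact ((tcat_bilinear A r.+1 s).2 z).
move: x; apply: ptens_eq; [exact: cL|by lin|move=> a].
move: y; apply: ptens_eq; [exact: cR|by lin|move=> b].
rewrite tcatE !tinsE; refine (etrans (tcatE _ _) _).
congr ptens; apply/ffunP => i; case: (unliftP (inord p) i) => [j ->|->].
  rewrite (finsE _ _ _).2; move: j; apply: ord_addP => j.
    have -> : lift (inord p : 'I_(r + s).+1) (lshift s j) = @lshift r.+1 s (lift (inord p) j).
      by apply: val_inj; have := ltn_ord j; rewrite /= !inordK //; lia.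
    by rewrite fcatl ?fcatSl ?fcatl (finsE _ _ _).2.
  have -> : lift (inord p : 'I_(r + s).+1) (rshift r j) = @rshift r.+1 s j.
    by apply: val_inj; have := ltn_ord j; rewrite /= !inordK // /bump; lia.
  by rewrite fcatr ?fcatSr ?fcatr.
rewrite (finsE _ _ _).1.
have -> : (inord p : 'I_(r + s).+1) = @lshift r.+1 s (inord p).
  by apply: val_inj; rewrite /= !inordK //; lia.
by rewrite fcatSl (finsE _ _ _).1.
Qed.

Lemma tins_catr r s (x : tpow A r) (y : tpow A s) p : (p <= s)%N ->
  tcat x (tins (inord p) 1 y)
  = castT (esym (addnS r s)) (tins (inord (r + p)) 1 (tcat x y)).
Proof.
move=> ps; move: x; apply: ptens_eq; [by lin|by lin|move=> a].
move: y; apply: ptens_eq; [by lin|by lin|move=> b].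
rewrite tcatE !tinsE tcatE; apply/esym/castT_pure => i.
case: (unliftP (inord (r + p)) i) => [j ->|->].
  rewrite (finsE _ _ _).2; move: j; apply: ord_addP => j.
    have -> : cast_ord (esym (addnS r s)) (lift (inord (r + p)) (lshift s j)) = lshift s.+1 j.
      by apply: val_inj; have := ltn_ord j; rewrite /= !inordK /bump; lia.
    by rewrite !fcatl.
  have -> : cast_ord (esym (addnS r s)) (lift (inord (r + p)) (rshift r j))
    = rshift r (lift (inord p) j).
    by apply: val_inj; have := ltn_ord j; rewrite /= !inordK /bump; lia.
  by rewrite !fcatr (finsE _ _ _).2.
rewrite (finsE _ _ _).1.
have -> : cast_ord (esym (addnS r s)) (inord (r + p)) = rshift r (inord p).
  by apply: val_inj; rewrite /= !inordK; lia.
by rewrite fcatr (finsE _ _ _).1.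
Qed.

Lemma tmerge_catl r s (x : tpow A r.+1) (y : tpow A s) p : (p < r)%N ->
  tcat (tmerge (inord p) (inord p.+1) x) y
  = @tmerge k A (r + s) (inord p) (inord p.+1) (tcat x y).
Proof.
move=> pr.
have uv : (inord p : 'I_r.+1) != inord p.+1.
  by rewrite -val_eqE /= !inordK; lia.
have UV : (inord p : 'I_(r + s).+1) != inord p.+1.
  by rewrite -val_eqE /= !inordK; lia.
have ML := @tmerge_linear k A (r + s) _ _ UV.
have cL : forall y : tpow A s, linear (fun x : tpow A r.+1 =>
    @tmerge k A (r + s) (inord p) (inord p.+1) (tcat x y)).
  move=> z c a b.
  refine (etrans (congr1 (@tmerge k A (r + s) _ _) ((tcat_bilinear A r.+1 s).1 z c a b)) _).
  exact (ML c _ _).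
have cR : forall x : tpow A r.+1, linear (fun y : tpow A s =>
    @tmerge k A (r + s) (inord p) (inord p.+1) (tcat x y)).
  move=> z c a b.
  refine (etrans (congr1 (@tmerge k A (r + s) _ _) ((tcat_bilinear A r.+1 s).2 z c a b)) _).
  exact (ML c _ _).
have mL := @tmerge_linear k A r _ _ uv.
move: x; apply: ptens_eq; [by lin|exact: cL|move=> a].
move: y; apply: ptens_eq; [by lin|exact: cR|move=> b].
rewrite tmergeE // tcatE.
pose c : {ffun 'I_(r + s).+1 -> A} := @fcat k A r.+1 s a b.
refine (esym (etrans (congr1 (@tmerge k A (r + s) _ _) (tcatE a b)) _)).
rewrite -/c (tmergeE c UV).
have eU : (inord p : 'I_(r + s).+1) = @lshift r.+1 s (inord p).
  by apply: val_inj; rewrite /= !inordK //; lia.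
have eV : (inord p.+1 : 'I_(r + s).+1) = @lshift r.+1 s (inord p.+1).
  by apply: val_inj; rewrite /= !inordK //; lia.
have cl i : c (@lshift r.+1 s i) = a i := fcatSl a b i.
have cr i : c (@rshift r.+1 s i) = b i := fcatSr a b i.
congr ptens; apply/ffunP; apply: ord_addP => j; rewrite [LHS]ffunE.
  have -> : lift (inord p : 'I_(r + s).+1) (lshift s j) = @lshift r.+1 s (lift (inord p) j).
    by apply: val_inj; have := ltn_ord j; rewrite /= !inordK //; lia.
  by rewrite eU eV !cl fcatl ffunE.
have -> : lift (inord p : 'I_(r + s).+1) (rshift r j) = @rshift r.+1 s j.
  by apply: val_inj; have := ltn_ord j; rewrite /= !inordK // /bump; lia.
rewrite cr fcatr ifF // -val_eqE /= !inordK; lia.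
Qed.

Lemma tmerge_catr r s (x : tpow A r) (y : tpow A s.+1) p : (p < s)%N ->
  tcat x (tmerge (inord p) (inord p.+1) y)
  = tmerge (inord (r + p)) (inord (r + p).+1) (castT (addnS r s) (tcat x y)).
Proof.
move=> ps.
have uv : (inord p : 'I_s.+1) != inord p.+1.
  by rewrite -val_eqE /= !inordK; lia.
have UV : (inord (r + p) : 'I_(r + s).+1) != inord (r + p).+1.
  by rewrite -val_eqE /= !inordK; lia.
have mL := @tmerge_linear k A s _ _ uv.
move: x; apply: ptens_eq; [by lin|by lin|move=> a].
move: y; apply: ptens_eq; [by lin|by lin|move=> b].
rewrite tmergeE // !tcatE castTE tmergeE //; congr ptens.
set c := finfun _; pose e := addnS r s.
have cE i : c (cast_ord e i) = fcat a b i by rewrite ffunE cast_ordK.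
have eU : inord (r + p) = cast_ord e (rshift r (inord p)).
  by apply: val_inj; rewrite /= !inordK; lia.
have eV : inord (r + p).+1 = cast_ord e (rshift r (inord p.+1)).
  by apply: val_inj; rewrite /= !inordK; lia.
apply/ffunP; apply: ord_addP => j; rewrite [RHS]ffunE.
  have -> : lift (inord (r + p)) (lshift s j) = cast_ord e (lshift s.+1 j).
    by apply: val_inj; have := ltn_ord j; rewrite /= !inordK /bump; lia.
  rewrite ifF ?cE ?fcatl // eV; apply/eqP => /(congr1 val) /=.
  by have := ltn_ord j; rewrite inordK; lia.
have -> : lift (inord (r + p)) (rshift r j) = cast_ord e (rshift r (lift (inord p) j)).
  by apply: val_inj; have := ltn_ord j; rewrite /= !inordK /bump; lia.
rewrite eU eV !cE !fcatr ffunE (inj_eq (@cast_ord_inj _ _ e)).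
by rewrite (inj_eq (@rshift_inj _ _)).
Qed.

Lemma t1_cat n (x : tpow A n) : tcat (t1 1) x = tins ord0 1 x :> tpow A n.+1.
Proof.
move: x; apply: ptens_eq; [exact ((tcat_bilinear A 1 n).2 (t1 1))|by lin|move=> a].
rewrite tinsE; refine (etrans (@tcatE k A 1 n [ffun => 1] a) _); congr ptens; apply/ffunP.
apply: (@ord_addP 1 n) => i.
  refine (etrans (@fcatl k A 1 n [ffun => 1] a i) _); rewrite ffunE.
  have -> : (@lshift 1 n i : 'I_n.+1) = ord0 by apply: val_inj; rewrite (ord1 i).
  by rewrite (finsE _ _ _).1.
refine (etrans (@fcatr k A 1 n [ffun => 1] a i) _).
have -> : (@rshift 1 n i : 'I_n.+1) = lift ord0 i by apply: val_inj.
by rewrite (finsE _ _ _).2.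
Qed.

Lemma cat_t1 n (x : tpow A n) :
  tcat x (t1 1) = castT (esym (addn1 n)) (tins (inord n) 1 x).
Proof.
move: x; apply: ptens_eq; [by lin|by lin|move=> a].
rewrite tinsE tcatE; apply/esym/castT_pure => i.
case: (unliftP (inord n) i) => [j ->|->].
  rewrite (finsE _ _ _).2 (_ : cast_ord _ _ = lshift 1 j) ?fcatl //.
  by apply: val_inj; have := ltn_ord j; rewrite /= !inordK /bump; lia.
rewrite (finsE _ _ _).1 (_ : cast_ord _ _ = rshift n ord0) ?fcatr ?ffunE //.
by apply: val_inj; rewrite /= !inordK; lia.
Qed.

Lemma ptens_split n m (a : {ffun 'I_(n + m) -> A}) :
  ptens a = tcat (ptens [ffun i => a (lshift m i)]) (ptens [ffun i => a (rshift n i)]).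
Proof.
rewrite tcatE; congr ptens; apply/ffunP.
by apply: ord_addP => i; rewrite ?fcatl ?fcatr ffunE.
Qed.

(** The left side shifts the letter 1 behind the first t letters; splitting v
    there turns it into an exchange of two factors of a product. *)
Lemma t1_mid t s (v : tpow A (t + s)) :
  castT (addnCA 1 t s) (tact (bperm s12 [tuple 1; t] (1 + (t + s))) (tcat (t1 1) v))
  = castT (esym (addnS t s)) (tins (inord t) 1 v).
Proof.
move: v; apply: ptens_eq; [by lin|by lin|move=> a].
rewrite ptens_split tcat_swap12 t1_cat (_ : ord0 = inord 0); last first.
  by apply: val_inj; rewrite /= inordK.
by rewrite tins_catr // addn0.
Qed.

(** A left inverse of tensoring with 1 on the left: it multiplies the first
    letter into the second one. The value 0 in degree 1, where there is no
    second letter, is arbitrary. *)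
Definition tbehead n : tpow A n.+1 -> tpow A n :=
  if n is n'.+1 then @tmerge k A n'.+1 ord0 (lift ord0 ord0) else fun=> 0.

Lemma t1_catK n (x : tpow A n) : (0 < n)%N -> tbehead (tcat (t1 1) x) = x.
Proof.
case: n x => // n x _ /=; rewrite t1_cat.
have mL := @tmerge_linear k A n.+1 ord0 (lift ord0 ord0) isT.
move: x; apply: ptens_eq; [by lin|by []|move=> a].
rewrite tinsE tmergeE //; congr ptens; apply/ffunP => j.
rewrite ffunE (inj_eq (@lift_inj _ ord0)) !(finsE _ _ _).2 (finsE _ _ _).1 mul1r.
by case: eqP => [->|].
Qed.
End Tensors.

(** * The derivation of an adapted structure *)
Section FromAdapted.
Variables (k : fieldType) (A : algType k).

Lemma tactK n (s : 'S_n) : cancel (@tact k A n s) (tact s^-1%g).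
Proof.
apply: ptens_eq => [||a]; [by lin|by []|rewrite !tactE; congr ptens].
by apply/ffunP => i; rewrite !ffunE invgK permK.
Qed.

Lemma castT_inj n m (e : n = m) : injective (@castT k A n m e).
Proof. by case: m / e. Qed.

Lemma t1_cat_inj n (x y : tpow A n) : (0 < n)%N ->
  tcat (t1 1) x = tcat (t1 1) y -> x = y.
Proof. by move=> n0 e; rewrite -(t1_catK x n0) e t1_catK. Qed.

Hypothesis two : (2%:R : k) != 0.
Variable B : tbracket A.
Hypothesis BP : id_adapted B.

(** The tensor E(y) with B(1, y) = 1 (x) E(y) that ida_one provides. *)
Definition tbder s (y : tpow A s) : tpow A s := tbehead (B (t1 1) y).

Lemma B_t1 s (y : tpow A s) : (0 < s)%N -> B (t1 1) y = tcat (t1 1) (tbder y).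
Proof. by move=> s0; rewrite /tbder; have [z ->] := ida_one BP y s0; rewrite t1_catK. Qed.

Lemma tbder_linear s : (0 < s)%N -> linear (@tbder s).
Proof.
move=> s0 c x y; apply: (t1_cat_inj s0); rewrite -B_t1 //.
rewrite ((tcat_bilinear A 1 s).2 (t1 1)) -!B_t1 //.
exact: (ida_bilinear BP _ s0).2.
Qed.

Lemma tbder_cast n m (e : n = m) (x : tpow A n) : tbder (castT e x) = castT e (tbder x).
Proof. by case: m / e. Qed.

Lemma tbder_block s l (tau : 'S_l) (d : l.-tuple nat) (y : tpow A s) : (0 < s)%N ->
  (forall i, (0 < tnth d i)%N) -> (\sum_(i < l) tnth d i)%N = s ->
  tbder (tact (bperm tau d s) y) = tact (bperm tau d s) (tbder y).
Proof.
move=> s0 d0 ds; apply: (t1_cat_inj s0); rewrite -B_t1 //.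
by rewrite (ida_blocks_right BP) // bperm_right // B_t1 // tact_cat tact1.
Qed.

Lemma B_castl n n' m (e : n = n') (e' : (n + m = n' + m)%N) (x : tpow A n) (y : tpow A m) :
  B (castT e x) y = castT e' (B x y).
Proof. by case: n' / e e' => e'; rewrite !castT_id. Qed.

Lemma tact_inj n (s : 'S_n) : injective (@tact k A n s).
Proof. exact: can_inj (tactK s). Qed.

(** The Leibniz identity with the letter 1 in the first slot. Each of its
    terms carries a letter 1 behind the first t letters, by insertion
    compatibility in the case of B (z (x) 1) y, and removing this letter is
    injective. *)
Lemma B_Leibniz1 t s (z : tpow A t) (y : tpow A s) : (0 < t)%N -> (0 < s)%N ->
  tcat z (tbder y) *+ 2 = B z y + tbder (tcat z y).
Proof.
move=> t0 s0; have ts0 : (0 < t + s)%N by rewrite addn_gt0 t0.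
apply: (t1_cat_inj ts0); apply: (@tact_inj _ (bperm s12 [tuple 1; t] (1 + (t + s)))).
apply: (@castT_inj _ _ (addnCA 1 t s)).
set J := fun v : tpow A (t + s) => castT (addnCA 1 t s)
  (tact (bperm s12 [tuple 1%N; t] (1 + (t + s))) (tcat (t1 1) v)).
rewrite -[LHS]/(J _) -[RHS]/(J _).
have JL : linear J by rewrite /J; lin.
rewrite mulr2n !(linD JL) -mulr2n.
have L := ida_Leibniz BP (t1 1) y z isT s0 t0.
rewrite !B_t1 // scaler_nat in L.
rewrite /J !tcat_swap12 L; congr (_ + _).
have e' : (t.+1 + s = t + 1 + s)%N by rewrite addn1.
rewrite cat_t1 (B_castl _ e') (ida_insert_left BP) //.
by rewrite (castT_trans _ _ (esym (addnS t s))) t1_mid.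
Qed.

(** The argument of bder_mul; that tbder commutes with the exchange of two
    blocks follows from the equivariance of B in its second argument. *)
Lemma tbder_cat n m (x : tpow A n) (y : tpow A m) : (0 < n)%N -> (0 < m)%N ->
  tbder (tcat x y) = tcat x (tbder y) + tcat (tbder x) y.
Proof.
move=> n0 m0; apply: (twice_inj two); rewrite /= mulrnDl.
have nm0 : (0 < n + m)%N by rewrite addn_gt0 n0.
have d0 i : (0 < tnth [tuple m; n] i)%N.
  by rewrite (tnth_nth 0%N); case: i => [] [|[|]].
have BE p q (z : tpow A p) (w : tpow A q) : (0 < p)%N -> (0 < q)%N ->
    B z w = tcat z (tbder w) *+ 2 - tbder (tcat z w).
  by move=> p0 q0; rewrite B_Leibniz1 // addrK.
have sum2 : (\sum_(i < 2) tnth [tuple m; n] i = m + n)%N.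
  by rewrite !big_ord_recl big_ord0 !(tnth_nth 0%N) /= addn0.
have := ida_antisym BP x y n0 m0; rewrite !BE //.
rewrite (linB (tact_linear _)) (linB (@castT_linear k A _ _ _)) !mulr2n.
rewrite (linD (tact_linear _)) (linD (@castT_linear k A _ _ _)) !tcat_swap.
have mn0 : (0 < m + n)%N by rewrite addnC.
rewrite -(tbder_block _ _ mn0 d0 sum2) -tbder_cast tcat_swap opprB => e.
by apply/eqP; rewrite -subr_eq addrAC -e subrK.
Qed.

Definition bD (a : A) : A := unt1 (tbder (t1 a)).

Lemma bD_linear : linear bD.
Proof.
exact: (lin_comp (@unt1_linear k A) (lin_comp (@tbder_linear 1 isT) (@t1_linear k A))).
Qed.

Lemma tbder_t1 a : tbder (t1 a) = t1 (bD a).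
Proof. by rewrite /bD unt1K. Qed.

(** A derivation of the tensor algebra is determined in degree 1. *)
Lemma tbderE s (y : tpow A s) : (0 < s)%N -> tbder y = tder bD y.
Proof.
have DL := bD_linear; move=> s0; have tL := tbder_linear s0.
move: y; apply: ptens_eq; [exact: tL|exact: tder_linear|].
case: s s0 {tL} => // s _; elim: s => [|s IH] a.
  by rewrite -[ptens a]unt1K tbder_t1 tder_t1.
rewrite ptens_cons.
rewrite [LHS](@tbder_cat 1 s.+1) // [RHS](@tder_cat _ _ _ DL 1 s.+1).
by rewrite IH tbder_t1 tder_t1.
Qed.

Lemma BE r s (x : tpow A r) (y : tpow A s) : (0 < r)%N -> (0 < s)%N ->
  B x y = tcat x (tder bD y) - tcat (tder bD x) y.
Proof.
move=> r0 s0; apply: (@addIr _ (tbder (tcat x y))).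
by rewrite -B_Leibniz1 // tbder_cat // -!tbderE // addrCA addrC subrK mulr2n.
Qed.

Lemma tmerge_t1 (a b : A) :
  tmerge (inord 0) (inord 1) (tcat (t1 a) (t1 b)) = t1 (a * b).
Proof.
have uv : (inord 0 : 'I_2) != inord 1 by rewrite -val_eqE /= !inordK.
pose c : {ffun 'I_2 -> A} := @fcat k A 1 1 [ffun => a] [ffun => b].
have e0 : inord 0 = lshift 1 (ord0 : 'I_1) by apply: val_inj; rewrite /= inordK.
have e1 : inord 1 = rshift 1 (ord0 : 'I_1) by apply: val_inj; rewrite /= inordK.
have c0 : c (inord 0) = a.
  by rewrite e0; refine (etrans (@fcatl k A 1 1 _ _ ord0) _); rewrite ffunE.
have c1 : c (inord 1) = b.
  by rewrite e1; refine (etrans (@fcatr k A 1 1 _ _ ord0) _); rewrite ffunE.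
rewrite /t1 tcatE -/c tmergeE //; congr ptens; apply/ffunP => i.
by rewrite [LHS]ffunE [RHS]ffunE c0 c1 ifT // -val_eqE /= !inordK // (ord1 i).
Qed.

(** B (1, -) commutes with the multiplication of the two letters of a (x) b.
*)
Lemma bD_mul a b : bD (a * b) = a * bD b + bD a * b.
Proof.
apply: (can_inj (@t1K k A)); rewrite -tbder_t1 -tmerge_t1.
have uv : (inord 0 : 'I_2) != inord 1 by rewrite -val_eqE /= !inordK.
have M := @ida_merge_right _ _ _ BP 1 1 (t1 1) (tcat (t1 a) (t1 b)) 0 isT isT isT.
rewrite !B_t1 // -tmerge_catr // in M; rewrite (t1_cat_inj _ M) //.
rewrite (@tbder_cat 1 1) // (linD (@tmerge_linear k A 1 _ _ uv)).
by rewrite !tbder_t1 !tmerge_t1 (linD (@t1_linear k A)).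
Qed.
End FromAdapted.

(** * The adapted structure of a derivation *)
Section TensorLinear.
Variables (k : fieldType) (A : algType k).

Lemma tcatDl n m (x x' : tpow A n) (y : tpow A m) :
  tcat (x + x') y = tcat x y + tcat x' y.
Proof. exact: (linD ((tcat_bilinear A n m).1 y)). Qed.
Lemma tcatBl n m (x x' : tpow A n) (y : tpow A m) :
  tcat (x - x') y = tcat x y - tcat x' y.
Proof. exact: (linB ((tcat_bilinear A n m).1 y)). Qed.
Lemma tcatDr n m (x : tpow A n) (y y' : tpow A m) :
  tcat x (y + y') = tcat x y + tcat x y'.
Proof. exact: (linD ((tcat_bilinear A n m).2 x)). Qed.
Lemma tactD n (s : 'S_n) (x y : tpow A n) : tact s (x + y) = tact s x + tact s y.
Proof. exact: (linD (tact_linear s)). Qed.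
Lemma tactB n (s : 'S_n) (x y : tpow A n) : tact s (x - y) = tact s x - tact s y.
Proof. exact: (linB (tact_linear s)). Qed.
Lemma castTD n m (e : n = m) (x y : tpow A n) : castT e (x + y) = castT e x + castT e y.
Proof. by case: m / e. Qed.
Lemma castTB n m (e : n = m) (x y : tpow A n) : castT e (x - y) = castT e x - castT e y.
Proof. by case: m / e. Qed.
End TensorLinear.

Section FromDer.
Variables (k : fieldType) (A : algType k) (D : A -> A).
Hypothesis DP : derivation D.

Let DL : linear D := DP.1.
Let DM := DP.2.

Definition tdbracket : tbracket A :=
  fun r s x y => tcat x (tder D y) - tcat (tder D x) y.

Lemma hatD n (x y : tpow A n) : hat (x + y) = hat x + hat y.
Proof. exact: opureDl. Qed.
Lemma hatN n (x : tpow A n) : hat (- x) = - hat x.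
Proof. exact: (linN (lin_hat (@lin_id k (tpow A n)))). Qed.
Lemma hatB n (x y : tpow A n) : hat (x - y) = hat x - hat y.
Proof. by rewrite hatD hatN. Qed.
Lemma hatZ n c (x : tpow A n) : hat (c *: x) = c *: hat x.
Proof. exact: (linZ (lin_hat (@lin_id k (tpow A n)))). Qed.

(** Through the injective map hat, identities that involve only tensors,
    products and block permutations are restrictions of those in O(A). *)
Lemma hat_tdbracket r s (x : tpow A r) (y : tpow A s) :
  hat (tdbracket x y) = dbracket (@oder k A D) (hat x) (hat y).
Proof. by rewrite /tdbracket /dbracket hatB !hat_cat !oder_hat. Qed.

Lemma tdbracketE r s (x : tpow A r) (y : tpow A s) :
  tdbracket x y = tcat x (tder D y) - tcat (tder D x) y.
Proof. by []. Qed.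

Lemma tdbracket_bilinear r s : bilinear_for *:%R *:%R (@tdbracket r s).
Proof.
have dr := @tder_linear k A D r DL; have ds := @tder_linear k A D s DL.
by split=> [y|x]; rewrite /tdbracket /=; lin.
Qed.

Let D1 : D 1 = 0 := der1 DM.

Lemma tdbracket_ins_left r s (x : tpow A r) (y : tpow A s) p : (p <= r)%N ->
  tdbracket (tins (inord p) 1 x) y = tins (inord p) 1 (tdbracket x y) :> tpow A (r + s).+1.
Proof.
move=> pr; rewrite tdbracketE tder_ins // !(tins_catl _ _ pr).
by rewrite -(linB (tins_linear _ _)).
Qed.

(** Antisymmetry, Jacobi and Leibniz are restrictions of the axioms for the
    extension of D to O(A); the other conditions hold because D is a derivation
    of tensors that kills 1 and commutes with block permutations, insertions of
    1 and multiplications of neighbours. *)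
Lemma tdbracket_id_adapted : id_adapted tdbracket.
Proof.
have dP := dbracket_dtp (oder_derivation DL DM).
split.
- by move=> r s _ _; apply: tdbracket_bilinear.
- move=> r s x y _ _; apply: hat_inj.
  by rewrite hatN -castO_hat -Ad_hat !hat_tdbracket (dtp_antisym dP).
- move=> r s t x y z _ _ _; apply: hat_inj.
  rewrite 2!hatD -!castO_hat -!Ad_hat !hat_tdbracket.
  refine (etrans (dtp_Jacobi dP (hat x) (hat y) (hat z)) _).
  by rewrite (lin0 (lin_hat (@lin_id _ _))).
- move=> r s t x y z _ _ _; apply: hat_inj.
  rewrite hatD hatZ -!castO_hat -!Ad_hat !hat_tdbracket hat_cat hat_tdbracket.
  by rewrite (dtp_Leibniz dP) !hat_cat.
- move=> r s t x y z _ _ _; rewrite !tdbracketE !tder_cat //.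
  rewrite tcatBl tcatDl tcatDr !tactB !castTB tactD castTD !tcat_back.
  by rewrite tactD castTD !tcat_swap23 leibniz_cancel scaler_nat.
- move=> s y _; exists (tder D y); rewrite tdbracketE tder_t1 // D1.
  by rewrite (lin0 (@t1_linear k A)) (lin0 ((tcat_bilinear A 1 s).1 y)) subr0.
- by move=> r s x y p _ _; apply: tdbracket_ins_left.
- move=> r s x y p _ _ ps; rewrite !tdbracketE tder_ins // !tins_catr //.
  by rewrite -(linB (@castT_linear k A _ _ _)) -(linB (tins_linear _ _)).
- move=> r s x y p _ _ pr.
  have uv : (inord p : 'I_r.+1) != inord p.+1 by rewrite -val_eqE /= !inordK; lia.
  have UV : (inord p : 'I_(r + s).+1) != inord p.+1.
    by rewrite -val_eqE /= !inordK; lia.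
  rewrite !tdbracketE tder_merge // !tmerge_catl //.
  exact (esym (linB (@tmerge_linear k A (r + s) _ _ UV) _ _)).
- move=> r s x y p _ _ ps.
  have uv : (inord p : 'I_s.+1) != inord p.+1 by rewrite -val_eqE /= !inordK; lia.
  have UV : (inord (r + p) : 'I_(r + s).+1) != inord (r + p).+1.
    by rewrite -val_eqE /= !inordK; lia.
  rewrite !tdbracketE tder_merge // !tmerge_catr //.
  by rewrite -(linB (tmerge_linear UV)) -(linB (@castT_linear k A _ _ _)).
- move=> r s x y l tau d _ _ _ ds; rewrite bperm_right // !tdbracketE tder_act //.
  by rewrite (linB (tact_linear _)) !tact_cat !tact1.
move=> r s x y l tau d _ _ _ ds; rewrite (bperm_left tau r ds) // !tdbracketE tder_act //.
by rewrite (linB (tact_linear _)) !tact_cat !tact1.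
Qed.
End FromDer.

(** * Equivalence of the conditions and classification *)
Section Characterization.
Variables (k : fieldType) (A : algType k).
Hypothesis two : (2%:R : k) != 0.

(** The transposition sends the first letter to the second position, so pi
    multiplies the two letters: the product of A is an operation of O(A). *)
Lemma opi_swap (x : tpow A 2) :
  opi (oact 1%g s12 (hat x)) = hat (tmerge (inord 0) (inord 1) x).
Proof.
rewrite /hat oactE tact1 !mulg1 opi_moved; last by rewrite /s12 tpermL.
rewrite /s12 tpermL; congr opure; last by apply/permP => i; rewrite !ord1.
by congr tmerge; apply: val_inj; rewrite /= inordK.
Qed.

Lemma hat_t1_inj : injective (fun a : A => hat (t1 a)).
Proof. by move=> a b /hat_inj /(can_inj (@t1K k A)). Qed.

Section Bracket.
Variable br : obracket A.
Hypothesis brP : double_transposed_Poisson br.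

Lemma restricts_delta : restricts_to_hat br -> delta_in_A br.
Proof.
move=> brT a; have [z e] := brT 0%N 1%N (tone0 A) (t1 a).
by exists (unt1 z); rewrite unt1K.
Qed.

(** The derivation d of the bracket commutes with the expression of the
    product by opi_swap, so the Leibniz rule for a (x) b gives the one for
    a b. *)
Lemma delta_induces : delta_in_A br -> exists D, induces_delta br D.
Proof.
move=> brA; pose D a := unt1 (oaug (delta br a)).
have dD := bder_derivation two brP.
have DE a : delta br a = hat (t1 (D a)).
  by have [b e] := brA a; rewrite /D e hatK t1K.
have DL : linear D.
  apply: (lin_comp (@unt1_linear k A)); apply: (lin_comp (@oaug_linear k A 1)).
  exact: (lin_comp (der_linear dD (n := 1)) (lin_hat (@t1_linear k A))).
exists D; split=> //; split=> // a b; apply: hat_t1_inj.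
have uv : (inord 0 : 'I_2) != inord 1 by rewrite -val_eqE /= !inordK.
rewrite -DE (linD (@t1_linear k A)) -!tmerge_t1 -(linD (tmerge_linear uv)).
have hc u v : hat (tcat (t1 u) (t1 v)) = omul (hat (t1 u)) (hat (t1 v)) :> OA A 2.
  exact (hat_cat (t1 u) (t1 v)).
rewrite -opi_swap hatD !hc -!DE -[delta br (a * b)]/(bder br (hat (t1 (a * b)))).
rewrite -tmerge_t1 -opi_swap (der_pi dD) (der_act dD) hc.
by congr (opi (oact _ _ _)); exact (der_mul dD (hat (t1 a)) (hat (t1 b))).
Qed.

Lemma induces_unique D D' : induces_delta br D -> induces_delta br D' -> D = D'.
Proof.
by move=> [_ e] [_ e']; apply: funext => a; apply: hat_t1_inj; rewrite /= -e -e'.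
Qed.

(** Both d and the extension of D to O(A) restrict to D on A. *)
Lemma induces_bracket D n m (x : OA A n) (y : OA A m) : induces_delta br D ->
  br x y = dbracket (@oder k A D) x y.
Proof.
move=> [[DL DM] DE]; rewrite br_dbracket //.
have dD := bder_derivation two brP.
have e := der_ext dD (oder_derivation DL DM).
have de a : bder br (hat (t1 a)) = oder D (hat (t1 a)).
  by rewrite oder_hat // tder_t1 // -DE.
by rewrite /dbracket !e.
Qed.
End Bracket.
End Characterization.

Lemma two_neq0 (k : closedFieldType) : [pchar k] =i pred0 -> (2%:R : k) != 0.
Proof. by move/pcharf0P => ->. Qed.

Theorem proposition4p8 (k : closedFieldType) (k0 : [pchar k] =i pred0)
    (A : algType k) :
  (forall br : obracket A, double_transposed_Poisson br ->
     [/\ restricts_to_hat br <-> delta_in_A br,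
         delta_in_A br <-> (exists! D : A -> A, induces_delta br D)
       & restricts_to_hat br ->
         exists D : A -> A, induces_delta br D /\
         exists B : tbracket A,
           [/\ restriction br B,
               id_adapted B
             & forall r s (x : tpow A r) (y : tpow A s),
                 (0 < r)%N -> (0 < s)%N ->
                 B r s x y = tcat x (tder D y) - tcat (tder D x) y]])
  /\
  (forall B : tbracket A, id_adapted B ->
     exists! br : obracket A,
       [/\ double_transposed_Poisson br,
           restricts_to_hat br,
           delta_in_A br,
           exists! D : A -> A, induces_delta br D
         & restriction br B]).
Proof.
have two := two_neq0 k0.
have brE br (brP : double_transposed_Poisson br) D : induces_delta br D ->
    forall r s (x : tpow A r) (y : tpow A s),
    br r s (hat x) (hat y) = hat (tdbracket D x y).
  move=> DP r s x y; rewrite (induces_bracket two brP _ _ DP) hat_tdbracket //.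
  by case: DP.
have exD br (brP : double_transposed_Poisson br) : delta_in_A br ->
    exists! D : A -> A, induces_delta br D.
  move=> /(delta_induces two brP) [D DP]; exists D; split=> // D'.
  exact: induces_unique.
split=> [br brP|B BP].
  have exR : delta_in_A br -> restricts_to_hat br.
    move=> /(delta_induces two brP) [D DP] r s x y.
    by exists (tdbracket D x y); apply: brE.
  split.
  - by split=> [/restricts_delta|].
  - by split=> [/(exD br brP)|[D [[_ DE] _]] a]; last by exists (D a).
  move=> /restricts_delta /(delta_induces two brP) [D DP]; exists D; split=> //.
  exists (tdbracket D); split=> //.
    by move=> r s x y _ _; apply: brE.
  by apply: tdbracket_id_adapted; case: DP.
pose D := bD B; have DL : linear D := bD_linear BP.
have DM : forall a b, D (a * b) = a * D b + D a * b := bD_mul two BP.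
have oD := oder_derivation DL DM.
pose br : obracket A := dbracket (@oder k A D).
have brP : double_transposed_Poisson br := dbracket_dtp oD.
have brT r s (x : tpow A r) (y : tpow A s) : br r s (hat x) (hat y) = hat (tdbracket D x y).
  by rewrite hat_tdbracket.
have brA : delta_in_A br.
  by apply: restricts_delta => r s x y; exists (tdbracket D x y).
have BD r s (x : tpow A r) (y : tpow A s) : (0 < r)%N -> (0 < s)%N ->
    B r s x y = tdbracket D x y by move=> r0 s0; apply: BE.
exists br; split.
  split=> //; [by move=> r s x y; exists (tdbracket D x y)|exact: exD|].
  by move=> r s x y r0 s0; rewrite brT BD.
move=> br' [brP' _ brA' _ brB'].
have [D' DP'] := delta_induces two brP' brA'.
have eD : D' = D.
  apply: funext => a; apply: (can_inj (@t1K k A)).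
  apply: (@t1_cat_inj k A 1) => //; apply: hat_inj.
  have D1' := der1 DP'.1.2; have D1 := der1 DM.
  have tL D0 : linear D0 -> D0 1 = 0 ->
      tdbracket D0 (t1 1) (t1 a) = tcat (t1 1) (t1 (D0 a)).
    move=> D0L D01; rewrite /tdbracket !tder_t1 // D01.
    by rewrite (lin0 (@t1_linear k A)) (lin0 ((tcat_bilinear A 1 1).1 _)) subr0.
  by rewrite -!tL // -?BD // -?brB' ?(brE _ brP' _ DP') //; case: DP' => [[]].
apply: functional_extensionality_dep => n; apply: functional_extensionality_dep => m.
apply: funext => x; apply: funext => y.
by rewrite (induces_bracket two brP' _ _ DP') eD.
Qed.
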